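(* Let $X$ be a normal $\mathbb{Q}$-Gorenstein (affine) variety over $k$, $\mathfrak{a}\subset \mathcal{O}_X$ a nonzero ideal and $t$ a non-negative real number. If $(X,\mathfrak{a}^t)$ is MJ-canonical (resp. MJ-log canonical, MJ-terminal, MJ-log terminal, MJ-klt), then it is canonical (resp. log canonical, terminal, log terminal, klt) in the usual sense.
   Context: $k$ is an uncountable algebraically closed field of characteristic zero. A variety is an irreducible reduced separated scheme of finite type over $k$; $d=\dim X$. A prime divisor $E$ over $X$ is a prime divisor on some normal $Y$ with a proper birational morphism $\varphi:Y\to X$; it is exceptional if $\varphi$ is not an isomorphism at the generic point of $E$. A log resolution of an ideal is a proper birational morphism $\varphi:Y\to X$ with $Y$ nonsingular such that the inverse image ideal is invertible and its divisor together with the exceptional locus has simple normal crossings. The Jacobian ideal $\mathcal{J}_X$ is the $d$-th Fitting ideal of $\Omega_X$. If $\varphi:Y\to X$ is a log resolution of $\mathcal{J}_X\mathfrak{a}$, write $\mathcal{J}_X\mathcal{O}_Y=\mathcal{O}_Y(-J_{Y/X})$ and $\mathfrak{a}\mathcal{O}_Y=\mathcal{O}_Y(-Z_{Y/X})$; such $\varphi$ factors through the Nash blow-up, so the image of $\varphi^*\Omega_X^d\to\Omega_Y^d$ is of the form $\mathcal{O}_Y(-\widehat K_{Y/X})\,\Omega_Y^d$ for an effective divisor $\widehat K_{Y/X}$ (the Mather discrepancy divisor). For a prime divisor $E$ on such a $Y$, $$a_{\mathrm{MJ}}(E;X,\mathfrak{a}^t):=\mathrm{ord}_E(\widehat K_{Y/X}-J_{Y/X}-tZ_{Y/X})+1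 .$$ $(X,\mathfrak{a}^t)$ is MJ-canonical (resp. MJ-log canonical, MJ-terminal, MJ-log terminal) if $a_{\mathrm{MJ}}(E;X,\mathfrak{a}^t)\ge 1$ (resp. $\ge 0$, $>1$, $>0$) for every exceptional prime divisor $E$ over $X$, and MJ-klt if $a_{\mathrm{MJ}}(E;X,\mathfrak{a}^t)>0$ for every prime divisor $E$ over $X$. The usual notions: with $rK_X$ Cartier, $K_{Y/X}=K_Y-\frac1r\varphi^*(rK_X)$ and $a(E;X,\mathfrak{a}^t)=\mathrm{ord}_E(K_{Y/X})-t\,\mathrm{val}_E(\mathfrak{a})+1$; $(X,\mathfrak{a}^t)$ is canonical (resp. log canonical, terminal, log terminal) if $a(E;X,\mathfrak{a}^t)\ge1$ (resp. $\ge0$, $>1$, $>0$) for every exceptional prime divisor $E$ over $X$, and klt if $a(E;X,\mathfrak{a}^t)>0$ for every prime divisor $E$ over $X$. *)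

(* Defs.v *)
From HB Require Import structures.
From mathcomp Require Import all_boot all_order all_algebra.
From mathcomp Require Import boolp classical_sets functions cardinality reals.

Set Implicit Arguments.
Unset Strict Implicit.
Unset Printing Implicit Defensive.

Import Order.TTheory GRing.Theory Num.Theory.
Local Open Scope classical_set_scope.
Local Open Scope ring_scope.

(* [univmod C] is the L-module generated by the symbols g : G that represents
   the functor M |-> {phi : G -> M | C M phi}, for classes C closed under
   composition with linear maps and cut out by linear identities: formal
   combinations of symbols, two of them being identified when every phi of the
   class gives them the same value.  It is used for Kaehler differentials
   (C = derivations) and for exterior powers (C = alternating maps). *)
Section UnivMod.
Context (L : comNzRingType) (G : choiceType).
Context (C : forall M : lmodType L, (G -> M) -> Prop).

Definition fsum (M : lmodType L) (phi : G -> M) (s : seq (L * G)) : M :=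
  \sum_(p <- s) p.1 *: phi p.2.

Definition univ_eq (s1 s2 : seq (L * G)) : bool :=
  `[< forall (M : lmodType L) (phi : G -> M), C phi ->
        fsum phi s1 = fsum phi s2 >].

Lemma univ_eq_refl : reflexive univ_eq.
Proof. by move=> s; apply/asboolP. Qed.
Lemma univ_eq_sym : symmetric univ_eq.
Proof.
by move=> s t; apply/asboolP/asboolP => h M phi /h.
Qed.
Lemma univ_eq_trans : transitive univ_eq.
Proof.
move=> t s u /asboolP h1 /asboolP h2; apply/asboolP => M phi Cphi.
by rewrite (h1 M phi Cphi) (h2 M phi Cphi).
Qed.
Canonical univ_eq_equiv :=
  EquivRel univ_eq univ_eq_refl univ_eq_sym univ_eq_trans.

Definition univmod := {eq_quot univ_eq_equiv}%qT.
HB.instance Definition _ := Choice.on univmod.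
HB.instance Definition _ := EqQuotient.on univmod.

Definition univ_ev (M : lmodType L) (phi : G -> M) (u : univmod) : M :=
  fsum phi (repr u).

Lemma univ_ev_pi (M : lmodType L) (phi : G -> M) s :
  C phi -> univ_ev phi (\pi_univmod s)%qT = fsum phi s.
Proof.
move=> Cphi; rewrite /univ_ev; case: piP => t /eqmodP /asboolP h.
by rewrite (h M phi Cphi).
Qed.

Lemma univ_ext (u v : univmod) :
  (forall (M : lmodType L) (phi : G -> M), C phi ->
     univ_ev phi u = univ_ev phi v) -> u = v.
Proof.
rewrite -[u]reprK -[v]reprK => h; apply/eqmodP/asboolP => M phi Cphi.
by have := h M phi Cphi; rewrite !univ_ev_pi.
Qed.

Definition univ_zero : univmod := (\pi_univmod [::])%qT.
Definition univ_add (u v : univmod) : univmod :=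
  (\pi_univmod (repr u ++ repr v))%qT.
Definition univ_scale (a : L) (u : univmod) : univmod :=
  (\pi_univmod [seq (a * p.1, p.2) | p <- repr u])%qT.
Definition univ_opp (u : univmod) : univmod := univ_scale (-1) u.

Section Ev.
Context (M : lmodType L) (phi : G -> M) (Cphi : C phi).
Lemma univ_ev0 : univ_ev phi univ_zero = 0.
Proof. by rewrite univ_ev_pi // /fsum big_nil. Qed.
Lemma univ_evD u v :
  univ_ev phi (univ_add u v) = univ_ev phi u + univ_ev phi v.
Proof. by rewrite univ_ev_pi // /fsum big_cat. Qed.
Lemma univ_evZ a u : univ_ev phi (univ_scale a u) = a *: univ_ev phi u.
Proof.
rewrite univ_ev_pi // /fsum big_map scaler_sumr.
by apply: eq_bigr => p _; rewrite scalerA.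
Qed.
Lemma univ_evN u : univ_ev phi (univ_opp u) = - univ_ev phi u.
Proof. by rewrite univ_evZ scaleN1r. Qed.
End Ev.

Lemma univ_addA : associative univ_add.
Proof. by move=> u v w; apply: univ_ext => M phi h; rewrite !univ_evD // addrA. Qed.
Lemma univ_addC : commutative univ_add.
Proof. by move=> u v; apply: univ_ext => M phi h; rewrite !univ_evD // addrC. Qed.
Lemma univ_add0 : left_id univ_zero univ_add.
Proof. by move=> u; apply: univ_ext => M phi h; rewrite univ_evD // univ_ev0 // add0r. Qed.
Lemma univ_addN : left_inverse univ_zero univ_opp univ_add.
Proof.
by move=> u; apply: univ_ext => M phi h; rewrite univ_evD // univ_evN // univ_ev0 // addNr.
Qed.
HB.instance Definition _ :=
  GRing.isZmodule.Build univmod univ_addA univ_addC univ_add0 univ_addN.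

Lemma univ_scaleA a b v : univ_scale a (univ_scale b v) = univ_scale (a * b) v.
Proof. by apply: univ_ext => M phi h; rewrite !univ_evZ // scalerA. Qed.
Lemma univ_scale1 : left_id 1 univ_scale.
Proof. by move=> v; apply: univ_ext => M phi h; rewrite univ_evZ // scale1r. Qed.
Lemma univ_scaleDr : right_distributive univ_scale +%R.
Proof.
move=> a u v; apply: univ_ext => M phi h.
by rewrite univ_evZ // !univ_evD // !univ_evZ // scalerDr.
Qed.
Lemma univ_scaleDl v : {morph univ_scale^~ v : a b / a + b}.
Proof.
move=> a b; apply: univ_ext => M phi h.
by rewrite univ_evZ // univ_evD // !univ_evZ // scalerDl.
Qed.
HB.instance Definition _ := GRing.Zmodule_isLmodule.Build L univmod
  univ_scaleA univ_scale1 univ_scaleDr univ_scaleDl.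

Definition univ_gen (g : G) : univmod := (\pi_univmod [:: (1, g)])%qT.

Lemma univ_ev_gen (M : lmodType L) (phi : G -> M) g :
  C phi -> univ_ev phi (univ_gen g) = phi g.
Proof. by move=> h; rewrite univ_ev_pi // /fsum big_seq1 scale1r. Qed.

Lemma univ_ev_linear (M : lmodType L) (phi : G -> M) :
  C phi -> linear (univ_ev phi).
Proof. by move=> h a u v; rewrite univ_evD // univ_evZ. Qed.

Lemma univ_fsum_gen (u : univmod) : u = fsum univ_gen (repr u).
Proof.
apply: univ_ext => M phi h; rewrite [in LHS]/univ_ev /fsum.
elim: (repr u) => [|p s IH]; first by rewrite !big_nil univ_ev0.
by rewrite !big_cons univ_evD // univ_evZ // univ_ev_gen // IH.
Qed.
End UnivMod.

Definition is_derivation (k L : comNzRingType) (j : k -> L)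
    (M : lmodType L) (D : L -> M) : Prop :=
  [/\ forall a b, D (a + b) = D a + D b,
      forall a b, D (a * b) = a *: D b + b *: D a
    & forall c, D (j c) = 0].

Definition Omega (k L : comNzRingType) (j : k -> L) :=
  univmod (fun M : lmodType L => @is_derivation k L j M).
HB.instance Definition _ (k L : comNzRingType) (j : k -> L) :=
  GRing.Lmodule.on (Omega j).

Definition dOmega (k L : comNzRingType) (j : k -> L) (a : L) : Omega j :=
  univ_gen _ a.

Lemma dOmega_derivation (k L : comNzRingType) (j : k -> L) :
  is_derivation j (dOmega j).
Proof.
split=> [a b|a b|c]; apply: univ_ext => M D hD; have [hA hM hC] := hD.
- by rewrite [RHS]univ_evD // !univ_ev_gen.
- by rewrite [RHS]univ_evD // !univ_evZ // !univ_ev_gen.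
- by rewrite univ_ev_gen // hC [RHS]univ_ev0.
Qed.

Definition ffun_upd (M : choiceType) n (v : {ffun 'I_n -> M}) (i : 'I_n) (x : M)
    : {ffun 'I_n -> M} := [ffun l => if l == i then x else v l].

Definition is_alternating (L : comNzRingType) (M : lmodType L) n
    (N : lmodType L) (phi : {ffun 'I_n -> M} -> N) : Prop :=
  (forall v i (a : L) x y,
     phi (ffun_upd v i (a *: x + y))
     = a *: phi (ffun_upd v i x) + phi (ffun_upd v i y)) /\
  (forall (v : {ffun 'I_n -> M}) i l, i != l -> v i = v l -> phi v = 0).

Definition Lambda (L : comNzRingType) n (M : lmodType L) :=
  univmod (fun N : lmodType L => @is_alternating L M n N).
HB.instance Definition _ (L : comNzRingType) n (M : lmodType L) :=
  GRing.Lmodule.on (Lambda n M).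

Definition wedge (L : comNzRingType) n (M : lmodType L) (v : 'I_n -> M) :
  Lambda n M := univ_gen _ (finfun v).

Definition mspan (L : comNzRingType) (O : set L) (V : lmodType L) (S : set V)
    : set V :=
  [set v | exists n (r : 'I_n -> L) (s : 'I_n -> V),
     (forall i, O (r i) /\ S (s i)) /\ v = \sum_i r i *: s i].

(* All generating families of M are used at once, as the ideal does not depend
   on the family; for n <= i the truncated size n - i is 0, and the empty
   minor is 1. *)
Definition fitting_ideal (L : comNzRingType) (M : lmodType L) (i : nat) : set L :=
  @mspan L setT L^o
    [set x | exists n (m : 'I_n -> M) (N : 'M[L]_(n - i, n))
                    (f : 'I_(n - i) -> 'I_n),
       [/\ mspan setT (range m) = setT,
           forall a, \sum_l N a l *: m l = 0
         & x = \det (colsub f N)]].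

Definition is_subring (L : comNzRingType) (B : set L) : Prop :=
  [/\ B 1, forall x y, B x -> B y -> B (x - y)
    & forall x y, B x -> B y -> B (x * y)].

Definition is_ideal (L : comNzRingType) (B P : set L) : Prop :=
  [/\ P `<=` B, P 0, forall x y, P x -> P y -> P (x + y)
    & forall b x, B b -> P x -> P (b * x)].

Definition is_prime (L : comNzRingType) (B P : set L) : Prop :=
  [/\ is_ideal B P, ~ P 1
    & forall x y, B x -> B y -> P (x * y) -> P x \/ P y].

(* B is a domain, so that 0 is prime *)
Definition is_height_one_prime (K : fieldType) (B P : set K) : Prop :=
  [/\ is_prime B P, P <> [set 0]
    & forall Q, is_prime B Q -> Q `<=` P -> Q = [set 0] \/ Q = P].

Definition alg_generated (k L : comNzRingType) (j : k -> L) (s : seq L) : set L :=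
  [set z | forall S, is_subring S -> (forall c, S (j c)) ->
                     (forall x, x \in s -> S x) -> S z].

Section SubringsOfField.
Context (K : fieldType).
Implicit Types (B O P V : set K).

Definition integral_over B (z : K) : Prop :=
  exists p : {poly K}, [/\ p \is monic, forall i, B p`_i & root p z].

(* integrally closed in the field K, which is the fraction field of B in all
   the uses below *)
Definition int_closed B : Prop := forall z, integral_over B z -> B z.

Definition localization B P : set K :=
  [set z | exists b s, [/\ B b, B s, ~ P s & z = b / s]].

(* the non-units of O; note that 0^-1 = 0 *)
Definition max_ideal O : set K := [set x | O x /\ (x = 0 \/ ~ O x^-1)].

Definition is_valuation_ring V : Prop :=
  is_subring V /\ forall x, V x \/ V x^-1.

Definition dominates V O : Prop :=
  O `<=` V /\ max_ideal O `<=` max_ideal V.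

Definition uniformizer O (pi : K) : Prop :=
  pi != 0 /\ max_ideal O = [set pi * r | r in O].

(* For a discrete valuation ring O and O-lattices N, N' in a line over K, the
   integer n with N = pi^n N'. *)
Definition rel_ord O (V : lmodType K) (N N' : set V) : int :=
  xget 0 [set n : int | exists2 pi, uniformizer O pi &
                          N = [set pi ^ n *: v | v in N']].

Definition ord_ideal O (S : set K) : int :=
  @rel_ord O K^o (@mspan K O K^o S) O.
Definition ord_fun O (f : K) : int := ord_ideal O [set f].

Definition is_subfield B : Prop :=
  is_subring B /\ forall x, B x -> B x^-1.

Definition algebraic_over_set B (z : K) : Prop :=
  exists p : {poly K}, [/\ p != 0, forall i, B p`_i & root p z].

Context (k : fieldType) (j : k -> K).

Definition field_generated (S : set K) : set K :=
  [set z | forall B, is_subfield B -> (forall c, B (j c)) -> S `<=` B -> B z].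

Definition has_trdeg (d : nat) : Prop :=
  exists x : 'I_d -> K,
    (forall z, algebraic_over_set (field_generated (range x)) z) /\
    (forall i, ~ algebraic_over_set
                   (field_generated (x @` [set l | l != i])) (x i)).

End SubringsOfField.

Section AffineVariety.
(* X = Spec A, for a domain A of finite type over k *)
Context (k : fieldType) (A : idomainType) (iota : {rmorphism k -> A}).
Context (d : nat).

Local Notation K := {fraction A}.

Definition to_ff : A -> K := @FracField.tofrac A.
Definition iotaK : k -> K := fun c => to_ff (iota c).
Definition AK : set K := range to_ff.

Definition finite_type : Prop :=
  exists s : seq A, alg_generated iota s = setT.

(* dim X, as the transcendence degree of the function field *)
Definition has_dim : Prop := has_trdeg iotaK d.

Definition is_normal : Prop := int_closed AK.

(* Varieties with a birational morphism to X, in the language of Zariski's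
   models: such a variety Y is given by finitely many affine charts
   Spec (U i), A <= U i <= K, two points of which are the same point of Y if
   and only if they have the same local ring in K.  By the valuative criteria,
   Y is separated and proper over X if and only if every valuation ring of K
   containing A dominates the local ring of exactly one point of Y. *)
Definition model_points n (U : 'I_n -> set K) : set (set K) :=
  [set O | exists i P, is_prime (U i) P /\ O = localization (U i) P].

Definition proper_birational_model n (U : 'I_n -> set K) : Prop :=
  [/\ forall i, exists s : seq K, U i = alg_generated iotaK s,
      forall i, AK `<=` U i
    & forall V, is_valuation_ring V -> AK `<=` V ->
        exists! O, model_points U O /\ dominates V O].

Definition normal_model n (U : 'I_n -> set K) : Prop :=
  forall i, int_closed (U i).

(* A prime divisor E on Y is represented by the local ring O_{Y,E} of its
   generic point, as a subring of K. *)
Definition prime_divisor_on n (U : 'I_n -> set K) (E : set K) : Prop :=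
  exists i P, is_height_one_prime (U i) P /\ E = localization (U i) P.

Definition prime_divisor_over (E : set K) : Prop :=
  exists n (U : 'I_n -> set K),
    [/\ proper_birational_model U, normal_model U & prime_divisor_on U E].

Definition center (E : set K) : set K := AK `&` max_ideal E.

Definition exceptional (E : set K) : Prop := E <> localization AK (center E).

Definition ratform := Lambda d (Omega iotaK : lmodType K).
HB.instance Definition _ := GRing.Lmodule.on ratform.

Definition dwedges (B : set K) : set ratform :=
  [set w | exists b : 'I_d -> K,
     (forall i, B (b i)) /\ w = wedge (fun i => dOmega iotaK (b i))].

(* For a codimension one point of a normal variety with local ring O, the
   module Omega^d_O is free of rank one, hence equal to its image in the
   rational d-forms. *)
Definition Omega_top (O : set K) : set ratform := mspan O (dwedges O).

(* The image of phi^* Omega_X^d -> Omega_Y^d at the generic point of E *)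
Definition pullback_Omega_top (E : set K) : set ratform :=
  mspan E (dwedges AK).

Definition jacobian_ideal : set A := fitting_ideal (Omega iota : lmodType A) d.

(* O_{Y,E} being a discrete valuation ring, J_X and a become principal in it
   and the image of phi^* Omega_X^d is a multiple of Omega_Y^d; hence the
   coefficients at E of the divisors K^_{Y/X}, J_{Y/X} and Z_{Y/X} make sense
   whether or not Y is a log resolution of J_X a, and are the same for all Y
   on which E is a divisor. *)
Definition ord_mather (E : set K) : int :=
  rel_ord E (pullback_Omega_top E) (Omega_top E).
Definition ord_jac (E : set K) : int := ord_ideal E (to_ff @` jacobian_ideal).

Definition ord_form (O : set K) (w : ratform) : int :=
  rel_ord O (mspan O [set w]) (Omega_top O).

(* f is an equation of r K_X near the point q of X, where K_X = div w *)
Definition local_equation (r : nat) (w : ratform) (q : set K) (f : K) : Prop :=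
  f != 0 /\
  exists s, [/\ AK s, ~ q s & forall P, is_height_one_prime AK P -> ~ P s ->
    ord_fun (localization AK P) f = ord_form (localization AK P) w *+ r].

Definition rK_Cartier (r : nat) : Prop :=
  exists2 w, w != 0 &
    forall q, is_prime AK q -> exists f, local_equation r w q f.

Definition Q_Gorenstein : Prop := exists2 r, (0 < r)%N & rK_Cartier r.

Section Pair.
Context (R : realType) (a : set A) (t : R).

(* ord_E K_{Y/X}, with K_{Y/X} = K_Y - r^-1 phi^*(r K_X), where K_Y and K_X are
   the divisors of the same rational form w; it does not depend on r, w, f. *)
Definition ord_KYX (E : set K) : R :=
  xget 0 [set c | exists r w f,
    [/\ (0 < r)%N, rK_Cartier r, w != 0, local_equation r w (center E) f
      & c = (ord_form E w)%:~R - (ord_fun E f)%:~R / r%:R]].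

Definition ord_a (E : set K) : R := (ord_ideal E (to_ff @` a))%:~R.

Definition a_MJ (E : set K) : R :=
  (ord_mather E)%:~R - (ord_jac E)%:~R - t * ord_a E + 1.

Definition a_usual (E : set K) : R := ord_KYX E - t * ord_a E + 1.

Definition forall_exceptional (Q : set K -> Prop) : Prop :=
  forall E, prime_divisor_over E -> exceptional E -> Q E.

Definition is_MJ_canonical := forall_exceptional (fun E => 1 <= a_MJ E).
Definition is_MJ_log_canonical := forall_exceptional (fun E => 0 <= a_MJ E).
Definition is_MJ_terminal := forall_exceptional (fun E => 1 < a_MJ E).
Definition is_MJ_log_terminal := forall_exceptional (fun E => 0 < a_MJ E).
Definition is_MJ_klt := forall E, prime_divisor_over E -> 0 < a_MJ E.

Definition is_canonical := forall_exceptional (fun E => 1 <= a_usual E).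
Definition is_log_canonical := forall_exceptional (fun E => 0 <= a_usual E).
Definition is_terminal := forall_exceptional (fun E => 1 < a_usual E).
Definition is_log_terminal := forall_exceptional (fun E => 0 < a_usual E).
Definition is_klt := forall E, prime_divisor_over E -> 0 < a_usual E.
End Pair.
End AffineVariety.

(* Main.v *)
(* The five implications follow from a_MJ E <= a_usual E for every prime divisor
   E over X, that is, from ord_E (K^_{Y/X} - J_{Y/X}) <= ord_E K_{Y/X}.

   Let w = a e be a rational d-form giving rise to r K_X = div f near the center
   q of E, and let the ideal F of A be such that F e is the A-module spanned by
   the d-forms db_1 ^ ... ^ db_d.  A maximal minor x of a matrix of n - d
   relations between n generators m_l of Omega_X comes with a multiple g e of e
   in F e, a wedge of d of the m_l, such that x F is contained in A g (duality
   between complementary minors).  At a point P of codimension one near q the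
   form e has order - ord_P F, so ord_P f = r (ord_P a + ord_P e), and the
   inclusion x F in A g says that (x a / g)^r / f is regular at P.  As X is
   normal, it is then regular at q, hence along E:
     ord_E f <= r (ord_E x + ord_E a - ord_E g) <= r (ord_E x + ord_E a - ord_E F),
   and the minimum over all x is the claim.

   This needs the Jacobian ideal to be nonzero, which holds because Omega_X is
   generated by d elements over the function field, in characteristic zero. *)

Require Import Defs.
From HB Require Import structures.
From mathcomp Require Import all_boot all_order all_algebra.
From mathcomp Require Import all_fingroup.
From mathcomp Require Import boolp classical_sets functions cardinality reals.
From mathcomp Require Import ring lra zify.

Set Implicit Arguments.
Unset Strict Implicit.
Unset Printing Implicit Defensive.

Import Order.TTheory GRing.Theory Num.Theory.
Local Open Scope classical_set_scope.
Local Open Scope ring_scope.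

(** * Noetherian normal domains *)

(** All rings live inside the function field K. A nonzero rational d-form, supplied by the
    Q-Gorenstein hypothesis, yields a derivation [c] from K to K^d with db_1 ^ ... ^ db_d =
    det(c(b_i)) e, so that every module of forms becomes a set of determinants and every order a
    least valuation of determinants. The same nonzero form gives the linear independence of the
    differentials of a transcendence basis.

    The orders in the statement are picked by [xget] with default 0. Each of them therefore needs a
    proof that a minimum exists: a lower bound, which comes from finite generation of the charts,
    and a nonzero element. For [ord_jac] the nonzero element is a nonvanishing Jacobian minor, which
    is why the Jacobian ideal has to be shown nonzero.

    The commutative algebra has one source: if z lies outside a Noetherian normal domain B, a
    maximal conductor among those of the B-multiples of z outside B is a prime of height one.
    Applied to a local ring, this gives both the discrete valuation rings and the extension of
    functions from codimension one. *)

Section Subring.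
Context (L : comNzRingType) (B : set L) (subB : is_subring B).

Lemma subring1 : B 1. Proof. by case: subB. Qed.
Lemma subringB x y : B x -> B y -> B (x - y).
Proof. by case: subB => _ h _; exact: h. Qed.
Lemma subringM x y : B x -> B y -> B (x * y).
Proof. by case: subB => _ _; apply. Qed.
Lemma subring0 : B 0.
Proof. by rewrite -(subrr 1); apply: subringB; exact: subring1. Qed.
Lemma subringN x : B x -> B (- x).
Proof. by rewrite -sub0r; apply: subringB; exact: subring0. Qed.
Lemma subringD x y : B x -> B y -> B (x + y).
Proof. by move=> Bx By; rewrite -[y]opprK; apply: subringB => //; exact: subringN. Qed.
Lemma subringX x n : B x -> B (x ^+ n).
Proof.
move=> Bx; elim: n => [|n IH]; first by rewrite expr0; exact: subring1.
by rewrite exprS; exact: subringM.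
Qed.
Lemma subring_sum (I : Type) (r : seq I) (P : pred I) (F : I -> L) :
  (forall i, P i -> B (F i)) -> B (\sum_(i <- r | P i) F i).
Proof. by move=> BF; apply: big_ind => //; [exact: subring0|exact: subringD]. Qed.
Lemma subring_prod (I : Type) (r : seq I) (P : pred I) (F : I -> L) :
  (forall i, P i -> B (F i)) -> B (\prod_(i <- r | P i) F i).
Proof. by move=> BF; apply: big_ind => //; [exact: subring1|exact: subringM]. Qed.
Lemma subring_det n (M : 'M[L]_n) : (forall i l, B (M i l)) -> B (\det M).
Proof.
move=> BM; apply: subring_sum => s _; apply: subringM; last exact: subring_prod.
by apply: subringX; apply: subringN; exact: subring1.
Qed.
End Subring.

Definition polys_over (L : comNzRingType) (B : set L) : set {poly L} :=
  [set p | forall i, B p`_i].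

Lemma polys_over_subring (L : comNzRingType) (B : set L) :
  is_subring B -> is_subring (polys_over B).
Proof.
move=> sB; split=> [i|p q Bp Bq i|p q Bp Bq i].
- by rewrite coef1; case: eqP => _; [exact: (subring1 sB)|exact: (subring0 sB)].
- by rewrite coefB; apply: (subringB sB).
- by rewrite coefM; apply: (subring_sum sB) => l _; apply: (subringM sB).
Qed.

Section Ideals.
Context (K : fieldType).
Implicit Types (B O P I J : set K).

Lemma ideal_sub B I x y : is_subring B -> is_ideal B I -> I x -> I y -> I (x - y).
Proof.
move=> sB [_ _ ID IM] Ix Iy; rewrite -mulN1r; apply: ID => //; apply: IM => //.
by apply: (subringN sB); exact: (subring1 sB).
Qed.

Lemma prime_mulN B P x y : is_prime B P -> B x -> B y -> ~ P x -> ~ P y -> ~ P (x * y).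
Proof. by move=> [_ _ h] Bx By nx ny /(h _ _ Bx By)[]. Qed.

Definition lincomb B (s : seq K) : set K :=
  [set x | exists c : nat -> K, (forall i, B (c i)) /\
     x = \sum_(i < size s) c i * s`_i].

Lemma lincomb_ideal B s : is_subring B -> (forall x, x \in s -> B x) ->
  is_ideal B (lincomb B s).
Proof.
move=> sB Bs; split.
- move=> x [c [Bc ->]]; apply: (subring_sum sB) => i _; apply: (subringM sB) => //.
  by apply: Bs; rewrite mem_nth.
- exists (fun=> 0); split=> [_|]; first exact: (subring0 sB).
  by rewrite big1 // => i _; rewrite mul0r.
- move=> x y [c [Bc ->]] [e [Be ->]]; exists (fun i => c i + e i); split.
    by move=> i; apply: (subringD sB).
  by rewrite -big_split; apply: eq_bigr => i _; rewrite mulrDl.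
- move=> b x Bb [c [Bc ->]]; exists (fun i => b * c i); split.
    by move=> i; apply: (subringM sB).
  by rewrite mulr_sumr; apply: eq_bigr => i _; rewrite mulrA.
Qed.

Lemma lincomb_gen B s x : is_subring B -> x \in s -> lincomb B s x.
Proof.
move=> sB xs; exists (fun i => (i == index x s)%:R); split=> [i|].
  by case: eqP => _; [exact: (subring1 sB)|exact: (subring0 sB)].
have ltx : (index x s < size s)%N by rewrite index_mem.
rewrite (bigD1 (Ordinal ltx)) //= eqxx mul1r nth_index // big1 ?addr0 // => i.
by rewrite -val_eqE /= => /negPf ->; rewrite mul0r.
Qed.

(* stated through its universal property, which avoids explicit combinations *)
Definition fin_gen B I : Prop :=
  exists s : seq K, (forall x, x \in s -> I x) /\
    (forall J, is_ideal B J -> (forall x, x \in s -> J x) -> I `<=` J).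

Definition noetherian B : Prop := forall I, is_ideal B I -> fin_gen B I.

Lemma fin_gen_lincomb B I : is_subring B -> is_ideal B I -> fin_gen B I ->
  exists s : seq K, (forall x, x \in s -> I x) /\ I `<=` lincomb B s.
Proof.
move=> sB [IB _ _ _] [s [Is gs]]; exists s; split=> //; apply: gs.
  by apply: lincomb_ideal => // x /Is/IB.
by move=> x; exact: lincomb_gen.
Qed.

(* the determinant trick *)
Lemma integral_of_stable_ideal B I y z : is_subring B -> noetherian B ->
  is_ideal B I -> I z -> z != 0 -> (forall x, I x -> I (y * x)) ->
  integral_over B y.
Proof.
move=> sB nB iI Iz z0 yI.
have [s [Is sI]] := fin_gen_lincomb sB iI (nB _ iI).
set n := size s.
have /choice[c cE] : forall i : 'I_n, exists c : nat -> K, (forall l, B (c l)) /\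
    y * s`_i = \sum_(l < n) c l * s`_l.
  by move=> i; apply: sI; apply/yI/Is; rewrite mem_nth.
(* Transposed, since [eigenvalue] refers to row vectors: the generators form a row that [M]
   multiplies by [y]. *)
pose M : 'M[K]_n := \matrix_(i, l) c l i.
have eigM : eigenvalue M y.
  apply/eigenvalueP; exists (\row_i s`_i).
    apply/rowP => i; rewrite !mxE (proj2 (cE i)); apply: eq_bigr => l _.
    by rewrite !mxE mulrC.
  (* The row of generators is nonzero because the nonzero [z] is a combination of them. *)
  apply/eqP => s0; move: z0; have [e [_ ->]] := sI _ Iz.
  rewrite big1 ?eqxx // => i _; move/rowP/(_ i): s0; rewrite !mxE => ->.
  by rewrite mulr0.
exists (char_poly M); split.
- exact: char_poly_monic.
- have := polys_over_subring sB => /subring_det; apply => i l.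
  rewrite !mxE; apply: (subringB (polys_over_subring sB)) => [m|m].
    rewrite coefMn coefX; case: eqP => _ /=; case: eqP => _ //=;
    by rewrite ?mulr1n ?mulr0n; (exact: (subring0 sB) || exact: (subring1 sB)).
  rewrite coefC; case: eqP => _; last exact: (subring0 sB).
  by have [] := cE l.
- by rewrite -eigenvalue_root_char.
Qed.

(** Zorn's lemma. The union [U] of a chain is an ideal; its finitely many generators already lie in
    one member of the chain, which is then an upper bound. *)
Lemma noetherian_max B (F : set (set K)) I0 : is_subring B -> noetherian B ->
  (forall I, F I -> is_ideal B I) -> F I0 ->
  exists2 I, F I & forall J, F J -> I `<=` J -> J `<=` I.
Proof.
move=> sB nB Fid FI0.
pose T := {I | F I}; pose t0 : T := exist _ I0 FI0.
pose R (s t : T) : bool := `[< projT1 s `<=` projT1 t >].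
have [||C Ctot|[I FI] Imax] := @ZL_preorder T t0 R.
- by move=> t; apply/asboolP.
- by move=> r s t /asboolP rs /asboolP st; apply/asboolP => x /rs/st.
- have [[c Cc]|C0] := pselect (exists c, C c); last first.
    by exists t0 => s Cs; case: C0; exists s.
  pose U : set K := [set x | exists2 u, C u & projT1 u x].
  have Uid : is_ideal B U.
    split.
    + by move=> x [[J FJ] _ /=]; have [JB _ _ _] := Fid _ FJ; exact: JB.
    + exists c => //; case: c Cc => J FJ _ /=; by have [_ J0 _ _] := Fid _ FJ.
    + move=> x y [u Cu ux] [v Cv vy].
      have [/asboolP uv|/asboolP vu] := Ctot _ _ Cu Cv.
        exists v => //; case: v Cv vy uv => J FJ _ /= Jy uJ.
        by have [_ _ JD _] := Fid _ FJ; apply: JD => //; exact: uJ.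
      exists u => //; case: u Cu ux vu => J FJ _ /= Jx vJ.
      by have [_ _ JD _] := Fid _ FJ; apply: JD => //; exact: vJ.
    + move=> b x Bb [[J FJ] CJ /= Jx]; exists (exist _ J FJ) => //=.
      by have [_ _ _ JM] := Fid _ FJ; exact: JM.
  have [s [Us gs]] := nB _ Uid.
  have [u Cu su] : exists2 u, C u & forall x, x \in s -> projT1 u x.
    elim: s Us {gs} => [|x s IH] Us; first by exists c.
    have [|u Cu su] := IH; first by move=> y ys; apply: Us; rewrite inE ys orbT.
    have [|v Cv vx] := Us x; first by rewrite inE eqxx.
    have [/asboolP uv|/asboolP vu] := Ctot _ _ Cu Cv.
      by exists v => // y; rewrite inE => /predU1P[->//|/su/uv].
    by exists u => // y; rewrite inE => /predU1P[->|/su//]; exact: vu.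
  exists u => -[J FJ] CJ; apply/asboolP => /= x Jx.
  case: u Cu su => u Fu Cu su /=; apply: gs su _ _; first exact: Fid.
  by exists (exist _ J FJ).
- exists I => // J FJ IJ.
  have /(_ _)/asboolP := Imax (exist _ J FJ); apply; exact/asboolP.
Qed.

(** The possible denominators of [y], that is, the annihilator of its class in K/B. *)
Definition conductor B y : set K := [set b | B b /\ B (b * y)].

Lemma conductor_ideal B y : is_subring B -> is_ideal B (conductor B y).
Proof.
move=> sB; split.
- by move=> b [].
- by split; rewrite ?mul0r; exact: (subring0 sB).
- by move=> b c [Bb Bby] [Bc Bcy]; split; rewrite ?mulrDl; apply: (subringD sB).
- by move=> b c Bb [Bc Bcy]; split; rewrite -?mulrA; apply: (subringM sB).
Qed.

Definition fraction_field B : Prop :=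
  forall z, exists b c, [/\ B b, B c, c != 0 & z = b / c].

(* An associated prime of K/B is conductor B y for some y; as y is not integral
   over B, multiplication by y cannot stabilise it, which makes it locally
   principal and forces its height to be one. *)
Lemma conductor_prime B z : is_subring B -> noetherian B -> int_closed B ->
  fraction_field B -> ~ B z ->
  exists y p, [/\ is_height_one_prime B (conductor B y),
    (forall x, B x -> B (x * z) -> B (x * y)), ~ B y, conductor B y p &
    ~ conductor B y (p * y) /\ B (p * y)].
Proof.
move=> sB nB cB fB nBz.
pose F : set (set K) := [set I | exists2 c, B c & ~ B (c * z) /\ I = conductor B (c * z)].
have [||I [c Bc [nBcz ->]] Imax] := @noetherian_max B F (conductor B z) sB nB.
- by move=> I [c _ [_ ->]]; exact: conductor_ideal.
- by exists 1; [exact: (subring1 sB)|rewrite mul1r].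
set y := c * z; set P := conductor B y.
have Pid : is_ideal B P by exact: conductor_ideal.
have Pprime : is_prime B P.
  split=> // [[_]|x1 x2 B1 B2 [_ B12y]]; first by rewrite mul1r.
  have [Bx1y|nBx1y] := pselect (B (x1 * y)); first by left.
  (* The conductor of [x1 * y] contains that of [y]; by maximality they agree, and [x2] lies in the
     former. *)
  right; apply: (Imax (conductor B (x1 * y))).
  - by exists (x1 * c); [apply: (subringM sB)|rewrite -mulrA].
  - move=> x [Bx Bxy]; split=> //; rewrite mulrCA; exact: (subringM sB).
  - by split=> //; rewrite mulrA (mulrC x2).
have [b [e [Bb Be e0 yE]]] := fB y.
have Pe : P e by split=> //; rewrite yE mulrC divfK.
(* If [y] stabilised [P], it would be integral over [B], hence in [B]. So some [p] in [P] has
   [p * y] in [B] but outside [P]; at [P] this product is a unit. *)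
have [yP|/existsNP[p /not_implyP[Pp nPyp]]] :=
    pselect (forall p, P p -> P (y * p)).
  by case: nBcz; apply: cB; apply: integral_of_stable_ideal sB nB Pid Pe e0 yP.
have Bpy : B (p * y) by case: Pp.
exists y, p; split=> //; last by rewrite mulrC in nPyp.
  split=> // [P0|Q [[QB Q0 QD QM] nQ1 Qp] QP].
    by move/eqP: e0; apply; rewrite -[e = 0]/([set 0] e) -P0.
  (* For [x] in [P], the product of [x] and [p * y] is a multiple of [p], hence in [Q]; as [p * y]
     is not in [Q], [x] is. *)
  have [Qpp|nQp] := pselect (Q p).
    right; apply/seteqP; split=> // x [Bx Bxy].
    have : Q (x * (p * y)).
      rewrite mulrCA mulrC; apply: QM => //.
    by move=> /Qp[]// /QP; rewrite mulrC => /nPyp.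
  (* Now [p] is not in [Q]. For [x] in [Q], the product of [p] and [x * y] is in [Q], hence so is
     [x * y]: [y] stabilises [Q], and a nonzero element of [Q] would make [y] integral. *)
  left; apply/seteqP; split=> [x Qx|x ->//].
  apply/eqP/negP => /negP x0; apply: nBcz; apply: cB.
  apply: (@integral_of_stable_ideal B Q y x) => // {x0 Qx}x Qx.
  have [Bx Bxy] : P x by exact: QP.
  have : Q (p * (x * y)) by rewrite mulrCA mulrC; exact: QM.
  by rewrite mulrC (mulrC y) => /Qp[] //; case: Pp.
by move=> x Bx Bxz; rewrite mulrCA; exact: (subringM sB).
Qed.
End Ideals.

(** * Localization of a domain at a prime *)

Section Localization.
Context (K : fieldType) (B P : set K) (sB : is_subring B) (pP : is_prime B P).
Local Notation O := (localization B P).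

Let P0 : P 0. Proof. by case: pP => -[]. Qed.
Let notP_neq0 s : ~ P s -> s != 0.
Proof. by move=> nP; apply/eqP => s0; apply: nP; rewrite s0. Qed.
Let PB : P `<=` B. Proof. by case: pP => -[]. Qed.
Let nP1 : ~ P 1. Proof. by case: pP. Qed.
Let PM b x : B b -> P x -> P (b * x).
Proof. by case: pP => -[_ _ _ h] _ _; exact: h. Qed.

Lemma loc_frac b s : B b -> B s -> ~ P s -> O (b / s).
Proof. by move=> Bb Bs nP; exists b, s. Qed.

Lemma loc_incl : B `<=` O.
Proof. by move=> b Bb; rewrite -[b]divr1; apply: loc_frac => //; exact: (subring1 sB). Qed.

Lemma loc_subring : is_subring O.
Proof.
split.
- by apply: loc_incl; exact: (subring1 sB).
- move=> _ _ [b [s [Bb Bs nPs ->]]] [c [t [Bc Bt nPt ->]]].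
  have -> : b / s - c / t = (b * t - c * s) / (s * t).
    by field; rewrite !notP_neq0.
  apply: loc_frac.
  + by apply: (subringB sB); apply: (subringM sB).
  + exact: (subringM sB).
  + exact: (prime_mulN pP).
- move=> _ _ [b [s [Bb Bs nPs ->]]] [c [t [Bc Bt nPt ->]]].
  rewrite mulf_div; apply: loc_frac; [exact: (subringM sB)..|].
  exact: (prime_mulN pP).
Qed.

Lemma loc_inv s : B s -> ~ P s -> O s^-1.
Proof. by move=> Bs nPs; rewrite -div1r; apply: loc_frac => //; exact: (subring1 sB). Qed.

Lemma loc_fraction_field : fraction_field B -> fraction_field O.
Proof.
move=> fB z; have [b [c [Bb Bc c0 ->]]] := fB z.
by exists b, c; split=> //; exact: loc_incl.
Qed.

Lemma contract_ideal I : is_ideal O I -> is_ideal B (B `&` I).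
Proof.
move=> [IO I0 ID IM]; split.
- by move=> x [].
- by split=> //; exact: (subring0 sB).
- by move=> x y [Bx Ix] [By Iy]; split; [exact: (subringD sB)|exact: ID].
- by move=> b x Bb [Bx Ix]; split; [exact: (subringM sB)|apply: IM => //; exact: loc_incl].
Qed.

Lemma contract_prime Q : is_prime O Q -> is_prime B (B `&` Q).
Proof.
move=> [iQ nQ1 Qp]; split; first exact: contract_ideal.
  by case.
move=> x y Bx By [_ Qxy].
by have [||Qx|Qy] := Qp x y _ _ Qxy; [exact: loc_incl..|left|right].
Qed.

Lemma contract_sub Q : is_prime O Q -> B `&` Q `<=` P.
Proof.
move=> [[_ _ _ QM] nQ1 _] x [Bx Qx]; apply: contrapT => nPx.
by apply: nQ1; rewrite -(mulVf (notP_neq0 nPx)); apply: QM => //; exact: loc_inv.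
Qed.

Lemma ideal_loc_contract I b s : is_ideal O I -> B b -> B s -> ~ P s ->
  I (b / s) <-> (B `&` I) b.
Proof.
move=> [_ _ _ IM] Bb Bs nPs; split=> [Ibs|[_ Ib]].
  by split=> //; rewrite -(divfK (notP_neq0 nPs) b) mulrC; apply: IM => //; exact: loc_incl.
by rewrite mulrC; apply: IM => //; exact: loc_inv.
Qed.

Lemma loc_noetherian : noetherian B -> noetherian O.
Proof.
move=> nB I iI; have [s [Is gs]] := nB _ (contract_ideal iI).
exists s; split=> [x /Is[]//|J iJ Js x Ix].
have [IO _ _ _] := iI; have [b [t [Bb Bt nPt xE]]] := IO _ Ix.
move: Ix; rewrite xE => /(ideal_loc_contract iI Bb Bt nPt) Ib.
apply/(ideal_loc_contract iJ Bb Bt nPt).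
apply: gs Ib; first exact: contract_ideal.
by move=> y ys; split; [case: (Is _ ys)|exact: Js].
Qed.

(** With [t] a common denominator of the coefficients of a monic equation of degree [n] for [z], the
    product [z * t] is integral over [B]: its equation [q] has the coefficient of degree i
    multiplied by [t ^+ (n - i)]. *)
Lemma loc_int_closed : int_closed B -> int_closed O.
Proof.
move=> cB z [p [pm Op pz]].
have /choice[c cE] : forall i, exists c, [/\ B c, ~ P c & B (p`_i * c)].
  move=> i; have [b [s [Bb Bs nPs ->]]] := Op i; exists s; split=> //.
  by rewrite divfK // notP_neq0.
pose n := (size p).-1.
have sp : size p = n.+1 by rewrite prednK // size_poly_gt0 monic_neq0.
pose t := \prod_(i < n.+1) c i.
have Bt : B t by apply: (subring_prod sB) => i _; case: (cE i).
have nPt : ~ P t.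
  suff [] : B t /\ ~ P t by [].
  rewrite /t; apply: (big_ind (fun t => B t /\ ~ P t)).
  - by split=> //; exact: (subring1 sB).
  - move=> x y [Bx nPx] [By nPy]; split; first exact: (subringM sB).
    exact: (prime_mulN pP).
  - by move=> i _; case: (cE i).
have tdiv i : (i < n.+1)%N -> B (p`_i * t).
  move=> lti; rewrite /t (bigD1 (Ordinal lti)) //= mulrA; apply: (subringM sB).
    by case: (cE i).
  by apply: (subring_prod sB) => l _; case: (cE l).
rewrite -(mulfK (notP_neq0 nPt) z); apply: loc_frac => //; apply: cB.
pose q := \poly_(i < n.+1) (p`_i * t ^+ (n - i)).
have qn : q`_n = 1.
  rewrite coef_poly ltnSn subnn expr0 mulr1; apply/eqP.
  by move: pm; rewrite qualifE /= /lead_coef sp.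
exists q; split.
- rewrite qualifE /= lead_coefE; suff -> : size q = n.+1 by rewrite qn.
  apply/eqP; rewrite eqn_leq size_poly /=; apply: contraT; rewrite -leqNgt => h.
  by move: qn; rewrite nth_default // => /esym/eqP; rewrite oner_eq0.
- move=> i; rewrite coef_poly; case: ifP => [lti|_]; last exact: (subring0 sB).
  move: (lti); rewrite ltnS leq_eqVlt => /predU1P[->|lt_in].
    rewrite subnn expr0 mulr1; have -> : p`_n = 1; last exact: (subring1 sB).
    by apply/eqP; move: pm; rewrite qualifE /= /lead_coef sp.
  rewrite -(subnSK lt_in) exprS mulrA; apply: (subringM sB); first exact: tdiv.
  exact: (subringX sB).
- apply/eqP; rewrite horner_poly.
  transitivity (t ^+ n * p.[z]); last by rewrite (rootP pz) mulr0.
  rewrite horner_coef sp mulr_sumr; apply: eq_bigr => i _.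
  have le_in : (i <= n)%N by rewrite -ltnS.
  have -> : t ^+ n = t ^+ (n - i) * t ^+ i by rewrite -exprD subnK.
  by rewrite exprMn; ring.
Qed.

Lemma loc_max_ideal : max_ideal O = [set z | exists b s, [/\ P b, B s, ~ P s & z = b / s]].
Proof.
apply/seteqP; split=> [z [[b [s [Bb Bs nPs ->]]] h]|_ [b [s [Pb Bs nPs ->]]]].
  have [Pb|nPb] := pselect (P b); first by exists b, s.
  case: h => [/eqP|[]].
    by rewrite mulf_eq0 invr_eq0 (negPf (notP_neq0 nPs)) (negPf (notP_neq0 nPb)).
  by rewrite invf_div; exact: loc_frac.
split; first by apply: loc_frac => //; exact: PB.
have [->|b0] := eqVneq b 0; first by left; rewrite mul0r.
right=> -[c [t [Bc Bt nPt E]]].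
have : P (t * s); last exact: (prime_mulN pP).
have -> : t * s = c * b; last exact: PM.
have t0 := notP_neq0 nPt; have s0 := notP_neq0 nPs.
have : (b / s)^-1 * (t * b) = c / t * (t * b) by rewrite E.
have -> : (b / s)^-1 * (t * b) = t * s by field; rewrite b0 s0.
by move=> ->; field; rewrite ?s0 ?t0.
Qed.

Lemma loc_max_ideal_prime : is_prime O (max_ideal O).
Proof.
have sO := loc_subring; split.
- split.
  + by move=> x [].
  + by split; [exact: (subring0 sO)|left].
  + rewrite loc_max_ideal => _ _ [b [s [Pb Bs nPs ->]]] [c [t [Pc Bt nPt ->]]].
    exists (t * b + s * c), (s * t); split.
    * by case: pP => -[_ _ PD _] _ _; apply: PD; exact: PM.
    * exact: (subringM sB).
    * exact: (prime_mulN pP).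
    * by field; rewrite !notP_neq0.
  + rewrite loc_max_ideal => _ _ [b [s [Bb Bs nPs ->]]] [c [t [Pc Bt nPt ->]]].
    exists (b * c), (s * t); split; rewrite ?mulf_div //; first exact: PM.
      exact: (subringM sB).
    exact: (prime_mulN pP).
- by move=> [_ []]; [move/eqP; rewrite oner_eq0|apply; rewrite invr1; exact: (subring1 sO)].
- move=> x y Ox Oy [_ h].
  have [Ox'|nOx] := pselect (O x^-1); last by left; split=> //; right.
  have [Oy'|nOy] := pselect (O y^-1); last by right; split=> //; right.
  case: h => [/eqP|[]]; last by rewrite invfM; exact: (subringM sO).
  rewrite mulf_eq0 => /orP[]/eqP ->; [left|right]; split=> //; try exact: (subring0 sO).
  all: by left.
Qed.

Lemma extend_prime Q : is_prime B Q -> Q `<=` P ->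
  is_prime O [set z | exists b s, [/\ Q b, B s, ~ P s & z = b / s]].
Proof.
move=> [[QB Q0 QD QM] nQ1 Qp] QP.
have contr b s : B b -> B s -> ~ P s ->
    (exists c t, [/\ Q c, B t, ~ P t & b / s = c / t]) -> Q b.
  move=> Bb Bs nPs [c [t [Qc Bt nPt E]]].
  have : Q (t * b).
    have -> : t * b = s * c; last exact: QM.
    have t0 := notP_neq0 nPt; have s0 := notP_neq0 nPs.
    have : b / s * (s * t) = c / t * (s * t) by rewrite E.
    have -> : b / s * (s * t) = t * b by field; rewrite ?s0 ?t0.
    by move=> ->; field; rewrite ?s0 ?t0.
  by move=> /Qp[]// /QP.
split.
- split.
  + by move=> _ [b [s [Qb Bs nPs ->]]]; apply: loc_frac => //; exact: QB.
  + by exists 0, 1; rewrite mul0r; split=> //; exact: (subring1 sB).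
  + move=> _ _ [b [s [Qb Bs nPs ->]]] [c [t [Qc Bt nPt ->]]].
    exists (t * b + s * c), (s * t); split.
    * by apply: QD; exact: QM.
    * exact: (subringM sB).
    * exact: (prime_mulN pP).
    * by field; rewrite !notP_neq0.
  + move=> _ _ [b [s [Bb Bs nPs ->]]] [c [t [Qc Bt nPt ->]]].
    exists (b * c), (s * t); split; rewrite ?mulf_div //; first exact: QM.
      exact: (subringM sB).
    exact: (prime_mulN pP).
- have B1 := subring1 sB.
  by move=> h; apply: nQ1; apply: (contr 1 1) => //; rewrite divr1.
- move=> _ _ [b [s [Bb Bs nPs ->]]] [c [t [Bc Bt nPt ->]]].
  rewrite mulf_div => h.
  have : Q (b * c).
    apply: contr h; [exact: (subringM sB)..|exact: (prime_mulN pP)].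
  by move=> /Qp[]// Qx; [left; exists b, s|right; exists c, t].
Qed.

Lemma contract_neq0 Q : is_ideal O Q -> Q <> [set 0] -> B `&` Q <> [set 0].
Proof.
move=> iQ Q0 E; apply: Q0; have [QO Q_0 QD QM] := iQ.
apply/seteqP; split=> [x Qx|x ->//].
have [b [s [Bb Bs nPs xE]]] := QO _ Qx; move: Qx; rewrite xE.
by move=> /(ideal_loc_contract iQ Bb Bs nPs); rewrite E => ->; rewrite /= mul0r.
Qed.

(** A prime [Q'] below the contraction extends to a prime [E] of [O] inside [Q], so [E] is 0 or [Q],
    and contracting back recovers [Q']. *)
Lemma contract_height_one Q : is_height_one_prime O Q ->
  is_height_one_prime B (B `&` Q).
Proof.
move=> [pQ Q0 hQ]; have [iQ nQ1 Qp] := pQ; have [QO Q_0 QD QM] := iQ.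
split; [exact: contract_prime|exact: contract_neq0|].
move=> Q' pQ' Q'sub; have Q'P : Q' `<=` P by move=> x /Q'sub; exact: contract_sub.
have Q'B : Q' `<=` B by case: pQ' => -[].
set E := [set z | exists b s, [/\ Q' b, B s, ~ P s & z = b / s]].
have Q'E : Q' `<=` E.
  by move=> x Qx; exists x, 1; rewrite divr1; split=> //; exact: (subring1 sB).
have [|E0|EQ] := hQ E (extend_prime pQ' Q'P).
- move=> _ [b [s [/Q'sub[Bb Qb] Bs nPs ->]]].
  by rewrite mulrC; apply: QM => //; exact: loc_inv.
- left; apply/seteqP; split=> [x /Q'E|x ->]; first by rewrite E0.
  by case: pQ' => -[].
right; apply/seteqP; split=> // x [Bx]; rewrite -EQ => -[b [s [Qb Bs nPs xE]]].
have : Q' (x * s) by rewrite xE divfK // notP_neq0.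
by case: pQ' => _ _ h /h[]// /Q'P.
Qed.
End Localization.

(** Every nonzero element of the field is a power of [pi] times a unit; the condition that [pi^-1]
    is not in [O] makes the exponent unique. *)
Definition is_dvr (K : fieldType) (O : set K) (pi : K) : Prop :=
  [/\ is_subring O, O pi, pi != 0, ~ O pi^-1 &
   forall x, x != 0 -> exists (n : int) u, [/\ u != 0, O u, O u^-1 & x = pi ^ n * u]].

Section NormalDomain.
Context (K : fieldType) (B : set K).
Context (sB : is_subring B) (nB : noetherian B) (cB : int_closed B) (fB : fraction_field B).

(** Algebraic Hartogs principle. If [z] is not regular at [q], some height-one prime [Q] of the
    local ring at [q] contains all denominators of [z]. Its contraction to [B] lies in [q], so it
    misses [s], and there [z] should have a denominator outside [Q]. *)
Lemma codim1_regular q s z : is_prime B q -> B s -> ~ q s ->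
  (forall P, is_height_one_prime B P -> ~ P s -> localization B P z) ->
  localization B q z.
Proof.
move=> pq Bs nqs zreg; apply: contrapT => nz.
have sO := loc_subring sB pq.
have [y [p [hQ zy nOy _ _]]] := conductor_prime sO (loc_noetherian sB pq nB)
  (loc_int_closed sB pq cB) (loc_fraction_field sB pq fB) nz.
set Q := conductor _ y in hQ.
have pQ : is_prime (localization B q) Q by case: hQ.
have hP := contract_height_one sB pq hQ.
have [|b [t [Bb Bt nPt zE]]] := zreg _ hP.
  by move=> /(contract_sub sB pq pQ).
have Bincl := loc_incl sB pq.
have t0 : t != 0.
  apply/eqP => t0; apply: nPt; rewrite t0; split; first exact: (subring0 sB).
  by case: pQ => -[].
apply: nPt; split=> //; split; first exact: Bincl.
by apply: zy; [exact: Bincl|apply: Bincl; rewrite zE mulrC divfK].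
Qed.

(** The inverse of a nonzero [e] in [P] is not in [O], so [conductor_prime] gives a prime [Q] of
    [O], which contracts to [P] as the height is one. Hence elements of [O] outside [Q] are units,
    among them [p * y], and [p] generates [Q]. *)
Lemma localization_dvr P : is_height_one_prime B P ->
  exists pi, is_dvr (localization B P) pi.
Proof.
move=> [pP Pn0 hP]; have [[PB P0 PD PM] nP1 Pp] := pP.
set O := localization B P.
have sO : is_subring O := loc_subring sB pP.
have nO : noetherian O := loc_noetherian sB pP nB.
have fO : fraction_field O := loc_fraction_field sB pP fB.
have BO : B `<=` O := loc_incl sB pP.
have [e Pe e0] : exists2 e, P e & e != 0.
  apply: contrapT => h; apply: Pn0; apply/seteqP; split=> [x Px|x ->//].
  by apply/eqP/negP => /negP x0; apply: h; exists x.
have nz : ~ O e^-1.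
  move=> [b [s [Bb Bs nPs E]]]; apply: nPs.
  have s0 : s != 0.
    by apply/eqP => s0; move/eqP: E; rewrite s0 invr0 mulr0 invr_eq0 (negPf e0).
  have -> : s = b * e.
    have : e^-1 * (e * s) = b / s * (e * s) by rewrite E.
    have -> : e^-1 * (e * s) = s by field.
    by move=> ->; field; rewrite ?s0 ?t0.
  exact: PM.
have [y [p [[pQ Qn0 _] zy nOy Qp [nQpy Opy]]]] := conductor_prime sO nO
  (loc_int_closed sB pP cB) fO nz.
set Q := conductor O y in pQ Qn0 Qp nQpy.
have QP : B `&` Q = P.
  have [E|//] := hP _ (contract_prime sB pP pQ) (contract_sub sB pP pQ).
  by have [iQ _ _] := pQ; case: (contract_neq0 sB pP iQ Qn0 E).
have [iQ nQ1 _] := pQ; have [QO Q_0 QD QM] := iQ.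
have unitO x : O x -> ~ Q x -> O x^-1.
  move=> [b [s [Bb Bs nPs ->]]] nQ; rewrite invf_div; apply: (loc_frac) => // Pb.
  by apply: nQ; apply/(ideal_loc_contract sB pP iQ Bb Bs nPs); rewrite QP.
have p0 : p != 0 by apply/eqP => p0; apply: nQpy; rewrite p0 mul0r.
have u0 : p * y != 0 by apply/eqP => E; apply: nQpy; rewrite E.
have Ou' : O (p * y)^-1 by exact: unitO.
have nOp' : ~ O p^-1 by move=> /QM/(_ Qp); rewrite mulVf.
have decO x : O x -> x != 0 -> exists (n : nat) u, [/\ u != 0, O u, O u^-1 & x = p ^+ n * u].
  move=> Ox x0.
  (* The principal ideals left after dividing [x] by powers of [p]. At a maximal one, [v] is not in
     [Q]: otherwise dividing by [p] once more would give a strictly larger ideal. *)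
  pose F : set (set K) := [set I | exists n v, [/\ O v, v != 0, x = p ^+ n * v &
     I = [set r * v | r in O]]].
  have [||I [n [v [Ov v0 xE ->]]] Imax] := @noetherian_max _ O F [set r * x | r in O] sO nO.
  - move=> _ [n [v [Ov v0 xE ->]]]; split.
    + by move=> _ [r Or <-]; exact: (subringM sO).
    + by exists 0; rewrite ?mul0r //; exact: (subring0 sO).
    + move=> _ _ [r Or <-] [r' Or' <-]; exists (r + r'); rewrite ?mulrDl //.
      exact: (subringD sO).
    + move=> b _ Ob [r Or <-]; exists (b * r); rewrite ?mulrA //.
      exact: (subringM sO).
  - by exists 0, x; rewrite expr0 mul1r.
  have [Qv|nQv] := pselect (Q v); last by exists n, v; split=> //; exact: unitO.
  have [_ Ovy] := Qv; have y0 : y != 0 by move: u0; rewrite mulf_eq0 negb_or => /andP[].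
  pose v' := v * y * (p * y)^-1.
  have vE : v = p * v' by rewrite /v'; field; rewrite y0.
  have v'0 : v' != 0 by apply: contraNneq v0 => E; rewrite vE E mulr0.
  have Ov' : O v' by exact: (subringM sO).
  have [|||r Or rE] := Imax [set r * v' | r in O] _ _ v'.
  - by exists n.+1, v'; split=> //; rewrite exprSr -mulrA -vE.
  - move=> _ [r Or <-]; exists (r * p); last by rewrite vE mulrA.
    by apply: (subringM sO) => //; exact: QO.
  - by exists 1; rewrite ?mul1r //; exact: (subring1 sO).
  case: nOp'; have -> : p^-1 = r.
    apply: (mulIf v'0); rewrite -{1}rE vE.
    by field.
  exact: Or.
exists p; split=> //; first exact: QO.
move=> x x0; have [b [c [Ob Oc c0 xE]]] := fO x.
have b0 : b != 0 by apply: contraNneq x0 => b0; rewrite xE b0 mul0r.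
have [n [u [v0 Ov Ov' bE]]] := decO b Ob b0.
have [m [w [w0 Ow Ow' cE]]] := decO c Oc c0.
exists (n%:Z - m%:Z), (u / w); split.
- by rewrite mulf_neq0 ?invr_eq0.
- exact: (subringM sO).
- by rewrite invf_div; exact: (subringM sO).
- by rewrite xE bE cE expfzDr // -exprnN -exprnP; field; rewrite w0 expf_neq0.
Qed.
End NormalDomain.

(** * Hilbert's basis theorem *)

Definition adjoin (K : fieldType) (B : set K) (x : K) : set K :=
  [set p.[x] | p in polys_over B].

Section HilbertBasis.
Context (K : fieldType) (B : set K) (x : K) (sB : is_subring B).
Implicit Types I : set K.

Let sBX := polys_over_subring sB.

Lemma adjoin_subring : is_subring (adjoin B x).
Proof.
split.
- by exists 1; [exact: (subring1 sBX)|rewrite hornerC].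
- move=> _ _ [p Bp <-] [q Bq <-]; exists (p - q); last by rewrite hornerD hornerN.
  exact: (subringB sBX).
- move=> _ _ [p Bp <-] [q Bq <-]; exists (p * q); last by rewrite hornerM.
  exact: (subringM sBX).
Qed.

Lemma polys_overC b : B b -> polys_over B b%:P.
Proof. by move=> Bb i; rewrite coefC; case: eqP => // _; exact: (subring0 sB). Qed.

Lemma polys_overX : polys_over B 'X.
Proof.
by move=> i; rewrite coefX; case: eqP => _; [exact: (subring1 sB)|exact: (subring0 sB)].
Qed.

Lemma adjoin_incl : B `<=` adjoin B x.
Proof. by move=> b Bb; exists b%:P; [exact: polys_overC|rewrite hornerC]. Qed.

Lemma adjoin_gen : adjoin B x x.
Proof. by exists 'X; [exact: polys_overX|rewrite hornerX]. Qed.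

(** [I] is pulled back to polynomials by evaluation at [x], which may be algebraic over [B]. Only
    the size is bounded, so the coefficient of degree [n] may vanish; this makes the set an
    ideal. *)
Definition lead_coefs I n : set K :=
  [set b | exists p, [/\ polys_over B p, I p.[x], (size p <= n.+1)%N & p`_n = b]].

Lemma lead_coefs_ideal I n : is_ideal (adjoin B x) I -> is_ideal B (lead_coefs I n).
Proof.
move=> [IB I0 ID IM]; split.
- by move=> _ [p [Bp _ _ <-]].
- by exists 0; rewrite horner0 size_poly0 coef0; split=> //; exact: (subring0 sBX).
- move=> _ _ [p [Bp Ip sp <-]] [q [Bq Iq sq <-]]; exists (p + q).
  rewrite coefD hornerD; split=> //; [exact: (subringD sBX)|exact: ID|].
  by apply: leq_trans (size_polyD _ _) _; rewrite geq_max sp.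
- move=> b _ Bb [p [Bp Ip sp <-]]; exists (b%:P * p).
  rewrite coefCM hornerM hornerC; split=> //.
  + by apply: (subringM sBX) => //; exact: polys_overC.
  + by apply: IM => //; exact: adjoin_incl.
  + by rewrite mul_polyC; exact: leq_trans (size_scale_leq _ _) sp.
Qed.

Lemma lead_coefs_le I m n b : is_ideal (adjoin B x) I -> (m <= n)%N ->
  lead_coefs I m b -> lead_coefs I n b.
Proof.
move=> [_ _ _ IM] le_mn [p [Bp Ip sp <-]]; exists (p * 'X^(n - m)); split.
- by apply: (subringM sBX) => //; apply: (subringX sBX); exact: polys_overX.
- rewrite hornerM hornerXn mulrC; apply: IM => //.
  by apply: (subringX adjoin_subring); exact: adjoin_gen.
- have [->|p0] := eqVneq p 0; first by rewrite mul0r size_poly0.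
  rewrite size_Mmonic ?monicXn // size_polyXn addnS /= -[in X in (_ <= X)%N](subnKC le_mn).
  by rewrite -addSn leq_add2r.
- by rewrite coefMXn ltnNge leq_subr /= subKn.
Qed.

(** The ascending chain of the ideals [lead_coefs I n] is stationary from some [N] on. Generators of
    [I] are the values at [x] of polynomials realising generators of these ideals for n up to
    [N]. *)
Lemma hilbert_basis : noetherian B -> noetherian (adjoin B x).
Proof.
move=> nB I iI; have [_ I0 _ _] := iI.
pose J := [set b | exists n, lead_coefs I n b].
have iJ : is_ideal B J.
  split.
  - by move=> b [n]; have [h _ _ _] := lead_coefs_ideal n iI; exact: h.
  - by exists 0%N; have [_ h _ _] := lead_coefs_ideal 0 iI.
  - move=> b c [n Jb] [m Jc]; exists (maxn n m).
    have [_ _ h _] := lead_coefs_ideal (maxn n m) iI.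
    by apply: h; apply: lead_coefs_le iI _ _; [|exact: Jb| |exact: Jc];
      rewrite leq_max leqnn ?orbT.
  - move=> b c Bb [n Jc]; exists n; have [_ _ _ h] := lead_coefs_ideal n iI.
    exact: h.
have [N JN] : exists N, J `<=` lead_coefs I N.
  have [s [Js gs]] := nB _ iJ.
  suff [N sN] : exists N, forall b, b \in s -> lead_coefs I N b.
    by exists N; apply: gs sN; exact: lead_coefs_ideal.
  elim: s Js {gs} => [|b s IH] Js; first by exists 0%N.
  have [|N sN] := IH; first by move=> c cs; apply: Js; rewrite inE cs orbT.
  have [|n Jb] := Js b; first by rewrite inE eqxx.
  exists (maxn n N) => c; rewrite inE => /predU1P[->|/sN Jc];
    apply: lead_coefs_le iI _ _; [|exact: Jb| |exact: Jc];
    by rewrite leq_max leqnn ?orbT.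
have /choice[s sE] n := nB _ (lead_coefs_ideal n iI).
have /choice[g gE] : forall nb : nat * K, exists p, lead_coefs I nb.1 nb.2 ->
    [/\ polys_over B p, I p.[x], (size p <= nb.1.+1)%N & p`_nb.1 = nb.2].
  move=> [n b]; have [[p pE]|nJ] := pselect (lead_coefs I n b); first by exists p.
  by exists 0 => /nJ.
pose t := flatten [seq [seq (g (n, b)).[x] | b <- s n] | n <- iota 0 N.+1].
exists t; split.
  move=> y /flatten_mapP[n _ /mapP[b bs ->]].
  by have [|] := gE (n, b); first by case: (sE n) => h _; exact: h.
(* By the universal form of [fin_gen], [I] has to lie in every ideal [I'] containing [t]. The point
   is that the intersection of [I] and [I'] has the same leading coefficients as [I]. *)
move=> I' iI' I't.
have iII : is_ideal (adjoin B x) (I `&` I').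
  have [h1 h2 h3 h4] := iI; have [h1' h2' h3' h4'] := iI'.
  split=> [y [/h1]//|//|y z [??] [??]|b y ? [??]]; split;
    [exact: h3|exact: h3'|exact: h4|exact: h4'].
have key n : (n <= N)%N -> lead_coefs I n `<=` lead_coefs (I `&` I') n.
  move=> le_nN; have [s1 s2] := sE n; apply: s2; first exact: lead_coefs_ideal.
  move=> b bs; have [|h1 h2 h3 h4] := gE (n, b); first exact: s1.
  exists (g (n, b)); split=> //; split=> //; apply: I't.
  apply/flatten_mapP; exists n; first by rewrite mem_iota.
  by apply/mapP; exists b.
suff main m (p : {poly K}) : (size p <= m)%N -> polys_over B p -> I p.[x] -> I' p.[x].
  move=> y Iy; have [IB _ _ _] := iI; have [p Bp pE] := IB _ Iy.
  by rewrite -pE; apply: main (leqnn _) Bp _; rewrite pE.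
(* Subtracting a polynomial [q] of the intersection with the same top coefficient lowers the size of
   [p]. *)
elim: m p => [p|m IH p sp Bp Ip].
  by rewrite leqn0 size_poly_eq0 => /eqP -> _ _; rewrite horner0; case: iI'.
have Jpm : lead_coefs I m p`_m by exists p.
have [q [Bq [Iq I'q] sq qE]] : lead_coefs (I `&` I') m p`_m.
  have [le_mN|/ltnW le_Nm] := leqP m N; first exact: key.
  by apply: lead_coefs_le iII le_Nm _; apply: key => //; apply: JN; exists m.
have sAx := adjoin_subring.
rewrite -(subrK q p) hornerD; have [_ _ ID _] := iI'; apply: ID => //.
apply: IH; last by rewrite hornerD hornerN; exact: ideal_sub sAx iI _ _.
  apply/leq_sizeP => i; rewrite leq_eqVlt => /predU1P[<-|lt_mi].
    by rewrite coefB qE subrr.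
  by rewrite coefB !nth_default ?subrr // ?(leq_trans sq) ?(leq_trans sp).
exact: (subringB sBX).
Qed.
End HilbertBasis.

(** * Finitely generated algebras inside a field *)

Section AlgGenerated.
Context (K : fieldType) (k : comNzRingType) (j : k -> K).

Lemma alg_generated_subring s : is_subring (alg_generated j s).
Proof.
split=> [S sS _ _|y z hy hz S sS jS Ss|y z hy hz S sS jS Ss].
- exact: (subring1 sS).
- by apply: (subringB sS); [exact: hy|exact: hz].
- by apply: (subringM sS); [exact: hy|exact: hz].
Qed.

Lemma alg_generated_base s c : alg_generated j s (j c).
Proof. by move=> S _ jS _; exact: jS. Qed.

Lemma alg_generated_gen s x : x \in s -> alg_generated j s x.
Proof. by move=> xs S _ _; apply. Qed.

Lemma alg_generated_nil : is_subring (range j) -> alg_generated j [::] = range j.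
Proof.
move=> sj; apply/seteqP; split=> [z|_ [c _ <-]]; last exact: alg_generated_base.
by apply=> // c; exists c.
Qed.

Lemma alg_generated_cons x s :
  alg_generated j (x :: s) = adjoin (alg_generated j s) x.
Proof.
have sS := alg_generated_subring s; have sS' := alg_generated_subring (x :: s).
apply/seteqP; split=> [z|_ [p Sp <-]].
  apply=> [|c|y]; first exact: adjoin_subring.
    by apply: adjoin_incl => //; exact: alg_generated_base.
  rewrite inE => /predU1P[->|ys]; first exact: adjoin_gen.
  by apply: adjoin_incl => //; exact: alg_generated_gen.
rewrite horner_coef; apply: (subring_sum sS') => i _; apply: (subringM sS').
  move=> S hS jS Ss; apply: Sp => // y ys; apply: Ss; by rewrite inE ys orbT.
by apply: (subringX sS'); apply: alg_generated_gen; rewrite inE eqxx.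
Qed.
End AlgGenerated.

Lemma alg_generated_noetherian (k K : fieldType) (j : {rmorphism k -> K}) s :
  noetherian (alg_generated j s).
Proof.
have sj : is_subring (range j).
  split=> [|_ _ [a _ <-] [b _ <-]|_ _ [a _ <-] [b _ <-]].
  - by exists 1; rewrite ?rmorph1.
  - by exists (a - b); rewrite ?rmorphB.
  - by exists (a * b); rewrite ?rmorphM.
elim: s => [|x s IH]; last first.
  by rewrite alg_generated_cons; apply: hilbert_basis IH; exact: alg_generated_subring.
rewrite alg_generated_nil // => I [IB I0 ID IM].
(* [range j] is a field: an ideal is generated by 1 or by the empty family. *)
have [[c Ic c0]|nI] := pselect (exists2 c, I (j c) & c != 0).
  exists [:: 1]; split=> [x|J [_ _ _ JM] J1 x Ix].
    rewrite inE => /eqP ->; rewrite -(rmorph1 j) -(mulVf c0) rmorphM.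
    by apply: IM => //; exists c^-1.
  by rewrite -[x]mulr1; apply: JM; [exact: IB|apply: J1; rewrite inE].
exists [::]; split=> // J [_ J0 _ _] _ x Ix; have [c _ cx] := IB _ Ix.
have [c0|c0] := eqVneq c 0; first by rewrite -cx c0 rmorph0.
by case: nI; exists c; rewrite ?cx.
Qed.

(** * Discrete valuation rings *)

Section Valuation.
Context (K : fieldType) (O : set K) (pi : K) (dvrO : is_dvr O pi).
Implicit Types (x y c u : K) (n m : int).

Let sO : is_subring O. Proof. by case: dvrO. Qed.
Let pi0 : pi != 0. Proof. by case: dvrO. Qed.

(** At 0 no exponent exists and the value is the default 0, whence the hypotheses [x != 0] below. *)
Definition dval x : int :=
  xget 0 [set n | exists u, [/\ u != 0, O u, O u^-1 & x = pi ^ n * u]].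

Lemma dvalE x : x != 0 -> exists u, [/\ u != 0, O u, O u^-1 & x = pi ^ dval x * u].
Proof.
case: dvrO => _ _ _ _ h x0.
exact: (@xgetPex _ 0 [set n : int | exists u, _] (h x x0)).
Qed.

Lemma dvr_expz n : O (pi ^ n) <-> 0 <= n.
Proof.
case: dvrO => _ Opi _ nOpi _; split=> [On|]; last first.
  by case: n => // n _; exact: (subringX sO).
rewrite leNgt; apply/negP => n0; apply: nOpi.
have -> : pi^-1 = pi ^ n * pi ^ (- n - 1).
  by rewrite -expfzDr // addrA subrr sub0r -invr_expz expr1z.
apply: (subringM sO) => //.
have : 0 <= - n - 1 by lia.
by case: (- n - 1) => // l _; exact: (subringX sO).
Qed.

Lemma dvr_val x : x != 0 -> O x <-> 0 <= dval x.
Proof.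
move=> /dvalE[u [u0 Ou Ou' xE]]; split=> [Ox|h]; last first.
  by rewrite xE; apply: (subringM sO) => //; exact/dvr_expz.
apply/dvr_expz; rewrite -[pi ^ _](mulfK u0) -xE; exact: (subringM sO).
Qed.

Lemma dval_unique x n u : u != 0 -> O u -> O u^-1 -> x = pi ^ n * u -> dval x = n.
Proof.
move=> u0 Ou Ou' xE; have pin m := expfz_neq0 m pi0.
have [|v [v0 Ov Ov' xE']] := @dvalE x; first by rewrite xE mulf_neq0.
have E : pi ^ dval x * v = pi ^ n * u by rewrite -xE'.
have : pi ^ (dval x - n) = u / v.
  by rewrite expfzDr // -invr_expz -(mulfK v0 (pi ^ dval x)) E; field; rewrite v0 pin.
have : pi ^ (n - dval x) = v / u.
  by rewrite expfzDr // -invr_expz -(mulfK u0 (pi ^ n)) -E; field; rewrite u0 pin.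
move=> h1 h2; apply/eqP; rewrite eq_le -(subr_ge0 n) -(subr_ge0 (dval x)).
by apply/andP; split; apply/dvr_expz; rewrite ?h1 ?h2; exact: (subringM sO).
Qed.

Lemma dvalM x y : x != 0 -> y != 0 -> dval (x * y) = dval x + dval y.
Proof.
move=> /dvalE[u [u0 Ou Ou' xE]] /dvalE[v [v0 Ov Ov' yE]].
apply: (@dval_unique _ _ (u * v)); rewrite ?mulf_neq0 //; try exact: (subringM sO).
  by rewrite invfM; exact: (subringM sO).
by rewrite {1}xE {1}yE expfzDr //; ring.
Qed.

Lemma dval1 : dval 1 = 0.
Proof.
apply: (@dval_unique _ _ 1); rewrite ?oner_eq0 ?invr1 ?mul1r ?expr0z //;
  exact: (subring1 sO).
Qed.

Lemma dvalV x : x != 0 -> dval x^-1 = - dval x.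
Proof.
move=> x0; have xV0 : x^-1 != 0 by rewrite invr_eq0.
by have := dvalM xV0 x0; rewrite mulVf // dval1; lia.
Qed.

Lemma dvalX x (n : nat) : x != 0 -> dval (x ^+ n) = dval x *+ n.
Proof.
move=> x0; elim: n => [|n IH]; first by rewrite expr0 dval1 mulr0n.
by rewrite exprS dvalM ?expf_neq0 // IH mulrS.
Qed.

Lemma dval_expz n : dval (pi ^ n) = n.
Proof.
apply: (@dval_unique _ _ 1); rewrite ?oner_eq0 ?invr1 ?mulr1 //;
  exact: (subring1 sO).
Qed.

(* x belongs to pi ^ n O; unlike n <= dval x, this treats x = 0 correctly *)
Definition vge n x : Prop := O (pi ^ (- n) * x).

Lemma vgeP n x : x != 0 -> vge n x <-> n <= dval x.
Proof.
move=> x0; rewrite /vge dvr_val ?mulf_neq0 ?expfz_neq0 // dvalM ?expfz_neq0 //.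
by rewrite dval_expz addrC subr_ge0.
Qed.

Lemma vge0x n : vge n 0. Proof. by rewrite /vge mulr0; exact: (subring0 sO). Qed.

Lemma vgeD n x y : vge n x -> vge n y -> vge n (x + y).
Proof. by rewrite /vge mulrDr; exact: (subringD sO). Qed.

Lemma vgeM n m x y : vge n x -> vge m y -> vge (n + m) (x * y).
Proof. by rewrite /vge opprD expfzDr // mulrACA; exact: (subringM sO). Qed.

Lemma vge_0E x : vge 0 x = O x.
Proof. by rewrite /vge oppr0 expr0z mul1r. Qed.

Lemma vgeZ n x y : O x -> vge n y -> vge n (x * y).
Proof. by rewrite -vge_0E -{2}[n]add0r; exact: vgeM. Qed.

Lemma vge_le n m x : m <= n -> vge n x -> vge m x.
Proof.
have [->|x0] := eqVneq x 0; first by move=> _ _; exact: vge0x.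
by move=> le_mn /(vgeP _ x0) h; apply/(vgeP _ x0); exact: le_trans h.
Qed.

Lemma uniformizer_pi : uniformizer O pi.
Proof.
split=> //; apply/seteqP; split=> [x [Ox h]|_ [r Or <-]]; last first.
  split; first by apply: (subringM sO) => //; case: dvrO.
  have [->|r0] := eqVneq r 0; [by left; rewrite mulr0|right].
  case: dvrO => _ _ _ nOpi _ h; apply: nOpi.
  by rewrite -(divfK r0 pi^-1) -invfM; exact: (subringM sO).
have [->|x0] := eqVneq x 0.
  by exists 0; rewrite ?mulr0 //; exact: (subring0 sO).
case: h => [/eqP|nOx']; first by rewrite (negPf x0).
exists (pi^-1 * x); last by rewrite mulVKf.
have v0 := (dvr_val x0).1 Ox.
have : vge 1 x; last by rewrite /vge exprN1.
apply/vgeP => //; rewrite -gtz0_ge1 lt_neqAle v0 andbT; apply/negP => /eqP vx.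
by apply: nOx'; apply/dvr_val; rewrite ?invr_eq0 // dvalV // -vx oppr0.
Qed.

(** [rel_ord] admits every uniformizer. Two of them divide each other in [O], so they have the same
    valuation as [pi]. *)
Lemma uniformizer_val rho : uniformizer O rho -> dval rho = 1.
Proof.
move=> [rho0 rhoE]; have [_ piE] := uniformizer_pi.
have [r Or Er] : [set rho * r | r in O] pi.
  rewrite -rhoE piE; exists 1; rewrite ?mulr1 //; exact: (subring1 sO).
have [s Os Es] : [set pi * r | r in O] rho.
  rewrite -piE rhoE; exists 1; rewrite ?mulr1 //; exact: (subring1 sO).
have r0 : r != 0 by apply: contraNneq pi0 => r0; rewrite -Er r0 mulr0.
have s0 : s != 0 by apply: contraNneq rho0 => s0; rewrite -Es s0 mulr0.
have vpi : dval pi = 1 by rewrite -[in LHS](expr1z pi) dval_expz.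
have : dval pi = dval rho + dval r by rewrite -[in LHS]Er dvalM.
have : dval rho = dval pi + dval s by rewrite -[in LHS]Es dvalM.
have := (dvr_val r0).1 Or; have := (dvr_val s0).1 Os; rewrite vpi; lia.
Qed.

(** * Lattices in a line and their relative order *)

Section Lattice.
Context (V : lmodType K).
Implicit Types (S : set V) (w : V).

Definition lattice n w : set V := [set c *: w | c in vge n].

(** The least order of a coefficient in [S], required to be attained; an element of least order
    generates the span over [O]. *)
Definition min_val S n w : Prop :=
  S `<=` lattice n w /\ exists c, [/\ c != 0, dval c = n & S (c *: w)].

Lemma scale_inj w c c' : w != 0 -> c *: w = c' *: w -> c = c'.
Proof.
move=> w0 /eqP; rewrite -subr_eq0 -scalerBl scaler_eq0 (negPf w0) orbF subr_eq0.
by move/eqP.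
Qed.

Lemma mspan_lattice S n w : min_val S n w -> mspan O S = lattice n w.
Proof.
move=> [Sn [c [c0 vc Sc]]]; apply/seteqP; split=> [_ [m [r [s [rs ->]]]]|_ [e he <-]].
  apply: big_ind; first by exists 0; [exact: vge0x|rewrite scale0r].
    move=> _ _ [e he <-] [f hf <-]; exists (e + f); rewrite ?scalerDl //; exact: vgeD.
  move=> i _; have [Or /Sn[e he <-]] := rs i.
  by exists (r i * e); [exact: vgeZ|rewrite scalerA].
exists 1%N, (fun=> e / c), (fun=> c *: w); split=> [_|].
  split=> //; rewrite -vge_0E mulrC -(addNr n); apply: vgeM he.
  by apply/vgeP; rewrite ?invr_eq0 // dvalV // vc.
by rewrite big_ord1 scalerA divfK.
Qed.

Lemma min_val_exists S n0 w : S `<=` lattice n0 w ->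
  (exists2 c, c != 0 & S (c *: w)) -> w != 0 -> exists n, min_val S n w.
Proof.
move=> Sn0 [c c0 Sc] w0.
have bnd e : e != 0 -> S (e *: w) -> n0 <= dval e.
  by move=> e0 /Sn0[f hf] /scale_inj -/(_ w0) fe; apply/vgeP; rewrite -?fe // fe.
(* Orders are shifted by the lower bound [n0] to become natural numbers, among which a least one
   exists. *)
pose P i := `[< exists e, [/\ e != 0, S (e *: w) & dval e = n0 + i%:Z] >].
have exP : exists i, P i.
  have := bnd _ c0 Sc; exists `|dval c - n0|%N; apply/asboolP; exists c; split=> //; lia.
case: (ex_minnP exP) => i /asboolP[e [e0 Se ve]] imin.
exists (n0 + i%:Z); split; last by exists e.
move=> x Sx; have [f hf fE] := Sn0 _ Sx; exists f => //.
have [->|f0] := eqVneq f 0; first exact: vge0x.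
apply/vgeP => //; rewrite -fE in Sx; have hn := bnd _ f0 Sx.
suff : (i <= `|dval f - n0|)%N by lia.
by apply: imin; apply/asboolP; exists f; split=> //; lia.
Qed.

(** Besides exhibiting [n - m], one has to exclude any other exponent for any uniformizer [rho];
    this follows by comparing the generators of the two lattices in both directions. *)
Lemma rel_ord_lattice n m w : w != 0 -> rel_ord O (lattice n w) (lattice m w) = n - m.
Proof.
move=> w0; apply: xget_unique.
  exists pi; first exact: uniformizer_pi.
  have shift a b x : vge b x -> vge (a + b) (pi ^ a * x).
    by move=> h; apply: vgeM => //; apply/vgeP; rewrite ?expfz_neq0 // dval_expz.
  apply/seteqP; split=> [_ [c hc <-]|_ [_ [c hc <-] <-]].
    exists ((pi ^ (m - n) * c) *: w).
      by exists (pi ^ (m - n) * c) => //; have := shift (m - n) n c hc; rewrite subrK.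
    by rewrite scalerA mulrA -expfzDr // addrA subrK subrr expr0z mul1r.
  exists (pi ^ (n - m) * c); rewrite ?scalerA //.
  by have := shift (n - m) m c hc; rewrite subrK.
move=> l [rho urho E]; have vrho := uniformizer_val urho; have [rho0 _] := urho.
have vrl : dval (rho ^ l) = l.
  case: (intP l) => [|i|i]; first by rewrite expr0z dval1.
    by rewrite -exprnP dvalX // vrho; lia.
  by rewrite -exprnN dvalV ?expf_neq0 // dvalX // vrho; lia.
have rl0 : rho ^ l != 0 by rewrite expfz_neq0.
have piV i : dval (pi ^ i) = i := dval_expz i.
have pin i : pi ^ i != 0 by rewrite expfz_neq0.
have [_ [e he <-] /esym] : [set rho ^ l *: v | v in lattice m w] (pi ^ n *: w).
  by rewrite -E; exists (pi ^ n) => //; apply/vgeP; rewrite ?piV.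
rewrite scalerA => /scale_inj -/(_ w0) eE.
have e0 : e != 0 by apply: contraNneq (pin n) => e0; rewrite eE e0 mulr0.
have [f hf] : lattice n w (rho ^ l *: (pi ^ m *: w)).
  rewrite E; exists (pi ^ m *: w) => //; exists (pi ^ m) => //; apply/vgeP => //.
  by rewrite piV.
rewrite scalerA => /scale_inj -/(_ w0) fE.
have h1 : n <= l + m.
  have : dval f = l + m by rewrite fE dvalM ?vrl ?piV.
  by move=> <-; apply/vgeP => //; rewrite fE mulf_neq0.
have h2 : l + m <= n.
  have : dval (pi ^ n) = l + dval e by rewrite eE dvalM // vrl.
  by rewrite piV => ->; rewrite lerD2l; apply/vgeP.
lia.
Qed.
End Lattice.
End Valuation.

(** * Alternating maps and minors *)

Definition is_submodule (L : comNzRingType) (O : set L) (V : lmodType L) (Q : set V) : Prop :=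
  [/\ Q 0, forall x y, Q x -> Q y -> Q (x + y) & forall a x, O a -> Q x -> Q (a *: x)].

Section Mspan.
Context (L : comNzRingType) (O : set L) (sO : is_subring O) (V : lmodType L).
Implicit Types S Q : set V.

Lemma submodule_sum Q (I : Type) (r : seq I) (P : pred I) (F : I -> V) :
  is_submodule O Q -> (forall i, P i -> Q (F i)) -> Q (\sum_(i <- r | P i) F i).
Proof. by move=> [Q0 QD _] QF; apply: big_ind. Qed.

Lemma mspan_min S Q : is_submodule O Q -> S `<=` Q -> mspan O S `<=` Q.
Proof.
move=> sQ SQ _ [n [r [s [rs ->]]]]; apply: submodule_sum => // i _.
by case: sQ => _ _; apply; [case: (rs i)|apply: SQ; case: (rs i)].
Qed.

Lemma mspan_incl S : S `<=` mspan O S.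
Proof.
move=> v Sv; exists 1%N, (fun=> 1), (fun=> v); rewrite big_ord1 scale1r.
by split=> // _; split=> //; exact: (subring1 sO).
Qed.

Lemma mspan_submodule S : is_submodule O (mspan O S).
Proof.
split.
- by exists 0%N, (fun=> 0), (fun=> 0); rewrite big_ord0; split=> // -[].
- move=> _ _ [n [r [s [rs ->]]]] [m [r' [s' [rs' ->]]]].
  exists (n + m)%N, (fun i => match fintype.split i with inl a => r a | inr b => r' b end),
    (fun i => match fintype.split i with inl a => s a | inr b => s' b end).
  split=> [i|]; first by case: (fintype.split i).
  rewrite big_split_ord /=; congr (_ + _); apply: eq_bigr => i _.
    by rewrite -/(unsplit (inl i)) unsplitK.
  by rewrite -/(unsplit (inr i)) unsplitK.
- move=> a _ Oa [n [r [s [rs ->]]]]; exists n, (fun i => a * r i), s; split.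
    by move=> i; have [Or Ss] := rs i; split=> //; exact: (subringM sO).
  by rewrite scaler_sumr; apply: eq_bigr => i _; rewrite scalerA.
Qed.
End Mspan.

Section Multilinear.
Context (L : comNzRingType) (M N : lmodType L) (n : nat).
Implicit Types (phi : {ffun 'I_n -> M} -> N) (v : {ffun 'I_n -> M}).

Definition is_multilinear phi : Prop := forall v i (a : L) x y,
  phi (ffun_upd v i (a *: x + y)) = a *: phi (ffun_upd v i x) + phi (ffun_upd v i y).

Lemma ffun_upd_id v i : ffun_upd v i (v i) = v.
Proof. by apply/ffunP => l; rewrite ffunE; case: eqP => // ->. Qed.

Lemma ffun_updC v i l x y : i != l ->
  ffun_upd (ffun_upd v i x) l y = ffun_upd (ffun_upd v l y) i x.
Proof.
move=> il; apply/ffunP => m; rewrite !ffunE; case: eqP => [->|//].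
by rewrite eq_sym (negPf il).
Qed.

Section Phi.
Context (phi : {ffun 'I_n -> M} -> N) (mphi : is_multilinear phi).

Lemma multilinearD v i x y :
  phi (ffun_upd v i (x + y)) = phi (ffun_upd v i x) + phi (ffun_upd v i y).
Proof. by have := mphi v i 1 x y; rewrite !scale1r. Qed.

Lemma multilinear0 v i : phi (ffun_upd v i 0) = 0.
Proof. by have := mphi v i (-1) 0 0; rewrite scaler0 addr0 scaleN1r addNr. Qed.

Lemma multilinear_sum v i m (r : 'I_m -> L) (s : 'I_m -> M) :
  phi (ffun_upd v i (\sum_l r l *: s l)) = \sum_l r l *: phi (ffun_upd v i (s l)).
Proof.
apply: (big_rec2 (fun x y => phi (ffun_upd v i x) = y)); first exact: multilinear0.
by move=> l y x _ <-; exact: mphi.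
Qed.

(** The arguments are expanded one after the other: in the induction the first [m] of them range
    over the span, the others still over [C]. *)
Lemma multilinear_span (O : set L) (C : set M) (Q : set N) : is_submodule O Q ->
  (forall v, (forall i, C (v i)) -> Q (phi v)) ->
  forall v, (forall i, mspan O C (v i)) -> Q (phi v).
Proof.
move=> sQ QC v vC.
suff h m v' : (m <= n)%N -> (forall i : 'I_n, (i < m)%N -> mspan O C (v' i)) ->
    (forall i : 'I_n, (m <= i)%N -> C (v' i)) -> Q (phi v').
  by apply: (h n) => // i; rewrite leqNgt ltn_ord.
elim: m v' {v vC} => [|m IH] v lt_mn vspan vC; first by apply: QC => i; exact: vC.
have [p [r [s [rs vE]]]] := vspan (Ordinal lt_mn) (leqnn _).
rewrite -(ffun_upd_id v (Ordinal lt_mn)) vE multilinear_sum.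
apply: (submodule_sum _ sQ) => l _; have [Or Cs] := rs l.
case: (sQ) => _ _; apply=> //; apply: IH => [|i lt_im|i le_mi]; first exact: ltnW.
  rewrite ffunE -val_eqE /= ltn_eqF //; apply: vspan; exact: ltnW.
rewrite ffunE -val_eqE /=; case: eqP => // /eqP im.
by apply: vC; rewrite ltn_neqAle eq_sym im.
Qed.
End Phi.

(** Expand [phi] with [v s + v t] in both places. Only vanishing is transported, so no sign has to
    be tracked. *)
Lemma alternating_swap phi v (s t : 'I_n) : is_alternating phi -> s != t ->
  phi v = 0 -> phi [ffun i => v (tperm s t i)] = 0.
Proof.
move=> [mphi aphi] st v0; have ts : t != s by rewrite eq_sym.
have h x : phi (ffun_upd (ffun_upd v s x) t x) = 0.
  by apply: (aphi _ s t) => //; rewrite !ffunE eqxx (negPf st) eqxx.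
have := h (v s + v t).
rewrite multilinearD // !(ffun_updC _ _ _ st) !multilinearD // -!(ffun_updC _ _ _ st).
rewrite !h addr0 add0r !ffun_upd_id v0.
have -> : ffun_upd (ffun_upd v s (v t)) t (v s) = [ffun i => v (tperm s t i)].
  apply/ffunP => i; rewrite !ffunE; case: tpermP => [->|->|/eqP is_ /eqP it].
  - by rewrite (negPf st) eqxx.
  - by rewrite eqxx.
  - by rewrite (negPf is_) (negPf it).
by rewrite ?addr0 ?add0r.
Qed.

(** By multilinearity the arguments may be taken among the [e l]. A repetition gives 0; otherwise
    they are a permutation of [e], a product of transpositions. *)
Lemma alternating_eq0 phi (e : 'I_n -> M) : is_alternating phi -> phi (finfun e) = 0 ->
  forall v, (forall i, mspan setT (range e) (v i)) -> phi v = 0.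
Proof.
move=> alt_phi phie; have [mphi aphi] := alt_phi.
apply: (multilinear_span mphi (Q := [set 0])).
  by split=> [|x y -> ->|a x _ ->] //=; rewrite ?addr0 ?scaler0.
move=> v ve; have /choice[g gE] i : exists l, v i = e l.
  by have [l _ <-] := ve i; exists l.
have [/injectiveP inj_g|] := boolP (injectiveb g); last first.
  move=> /injectivePn[i [l il gil]]; apply: (aphi _ i l) => //.
  by rewrite !gE gil.
have [ts pE _] := prod_tpermP (perm inj_g).
have -> : v = [ffun i => e (perm inj_g i)] by apply/ffunP => i; rewrite ffunE permE gE.
rewrite /= pE; elim: ts {pE} => [|[s t] ts IH].
  by rewrite big_nil -[RHS]phie; congr phi; apply/ffunP => i; rewrite !ffunE perm1.
rewrite big_cons /=; set u := (\prod_(_ <- _) _)%g in IH *.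
have [<-|st] := eqVneq s t; first by rewrite tperm1 mul1g.
rewrite -[RHS](alternating_swap alt_phi st IH); congr phi.
by apply/ffunP => i; rewrite !ffunE permM.
Qed.
End Multilinear.

Lemma det_alternating (L : comNzRingType) n :
  @is_alternating L 'rV[L]_n n L^o (fun v => \det (\matrix_i v i)).
Proof.
split=> [v i a x y|v i l il vil].
  rewrite [RHS](_ : _ = a * \det (\matrix_l ffun_upd v i x l) +
                        1 * \det (\matrix_l ffun_upd v i y l));
    last by rewrite mul1r.
  apply: (determinant_multilinear (i0 := i)).
  - by rewrite !rowK !ffunE eqxx scale1r.
  - by apply/matrixP => l m; rewrite !mxE !ffunE eq_sym (negPf (neq_lift _ _)).
  - by apply/matrixP => l m; rewrite !mxE !ffunE eq_sym (negPf (neq_lift _ _)).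
apply: (determinant_alternate il) => m.
by rewrite !mxE vil.
Qed.

Lemma det_multilinear (L : comNzRingType) n :
  @is_multilinear L 'rV[L]_n L^o n (fun v => \det (\matrix_i v i)).
Proof. by case: (det_alternating L n). Qed.

(** Both sides are alternating in the rows [C], and their difference [psi] vanishes on the standard
    basis, hence everywhere. *)
Lemma alternating_det (L : comNzRingType) (M N : lmodType L) n
    (phi : {ffun 'I_n -> M} -> N) (e : 'I_n -> M) (C : 'I_n -> 'rV[L]_n) :
  is_alternating phi ->
  phi [ffun i => \sum_l C i 0 l *: e l] = \det (\matrix_i C i) *: phi (finfun e).
Proof.
move=> alt_phi; have [mphi aphi] := alt_phi; have [mdet adet] := det_alternating L n.
pose comb (v : {ffun 'I_n -> 'rV[L]_n}) := [ffun i => \sum_l v i 0 l *: e l].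
pose psi v : N := phi (comb v) - \det (\matrix_i v i) *: phi (finfun e).
have comb_upd v i x :
    comb (ffun_upd v i x) = ffun_upd (comb v) i (\sum_l x 0 l *: e l).
  by apply/ffunP => l; rewrite !ffunE; case: eqP.
have psi_alt : is_alternating psi.
  split=> [v i a x y|v i l il vil]; rewrite /psi.
    rewrite !comb_upd mdet scalerBr addrACA -opprD.
    rewrite scalerDl -scalerA; congr (_ - _); rewrite -mphi.
    congr (phi (ffun_upd _ _ _)); rewrite scaler_sumr -big_split.
    by apply: eq_bigr => l _; rewrite !mxE scalerDl scalerA.
  rewrite (aphi _ i l) //; last by rewrite !ffunE vil.
  by rewrite (adet _ i l) // scale0r subrr.
suff : psi (finfun C) = 0.
  move=> /eqP; rewrite subr_eq0 => /eqP; set D := \det _; set D' := \det _.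
  have -> : D = D' by congr (\det _); apply/matrixP => i l; rewrite !mxE ffunE.
  by move=> <-; congr phi; apply/ffunP => i; rewrite !ffunE.
apply: (alternating_eq0 (e := fun i => delta_mx 0 i) psi_alt) => [|i].
  rewrite /psi.
  have -> : \matrix_i (finfun (delta_mx 0) : {ffun 'I_n -> 'rV[L]_n}) i = 1%:M.
    by apply/matrixP => i l; rewrite !mxE ffunE !mxE eqxx eq_sym.
  rewrite det1 scale1r; apply/eqP; rewrite subr_eq0; apply/eqP; congr phi.
  apply/ffunP => i; rewrite !ffunE (bigD1 i) //= big1 => [|l li].
    by rewrite mxE !eqxx scale1r addr0.
  by rewrite mxE (negPf li) andbF scale0r.
rewrite ffunE; exists n, (fun l => C i 0 l), (fun l => delta_mx 0 l).
by split=> [l|]; [split=> //; exists l|rewrite -row_sum_delta].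
Qed.

(** Laplace expansion along the first [m] columns, one at a time. Rows are selected by arbitrary
    maps [h], so that the induction merely composes them with [lift i]. *)
Lemma det_minors (L : comNzRingType) (O : set L) (sO : is_subring O) (Q : set L^o) m d
    (M : 'M[L]_(m + d)) : is_submodule O Q ->
  (forall i (l : 'I_m), O (M i (lshift d l))) ->
  (forall h : 'I_d -> 'I_(m + d), Q (\det (\matrix_(i, l) M (h i) (rshift m l)))) ->
  Q (\det M).
Proof.
move=> sQ; elim: m M => [|m IH] M OM QM.
  have -> : M = \matrix_(i, l) M i (rshift 0 l).
    by apply/matrixP => i l; rewrite mxE; congr (M _ _); apply: val_inj.
  exact: QM.
rewrite (@expand_det_col _ (m + d).+1 M (lshift d ord0)).
apply: (submodule_sum _ sQ) => i _; rewrite /cofactor mulrA.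
have [_ _ QZ] := sQ; apply: QZ.
  by apply: (subringM sO) => //; apply: (subringX sO); apply: (subringN sO); exact: (subring1 sO).
have liftr l : lift (lshift d (ord0 : 'I_m.+1)) (rshift m l) = rshift m.+1 l.
  exact: val_inj.
apply: IH => [p l|h].
  rewrite !mxE; have -> : lift (lshift d (ord0 : 'I_m.+1)) (lshift d l) = lshift d (lift ord0 l).
    exact: val_inj.
  exact: OM.
have -> : \matrix_(p, l) row' i (col' (lshift d ord0) M) (h p) (rshift m l) =
    \matrix_(p, l) M (lift i (h p)) (rshift m.+1 l).
  by apply/matrixP => p l; rewrite !mxE liftr.
exact: QM.
Qed.

(* [N; T] * [E_f | W] = [N_f, 0; T E_f, T W], where E_f selects the columns f *)
Lemma relation_minor (K : fieldType) (O : set K) (sO : is_subring O) m n d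
    (N : 'M[K]_(m, n)) (f : 'I_m -> 'I_n) (W : 'M[K]_(n, d)) :
  (m + d)%N = n -> (forall i l, O (N i l)) -> N *m W = 0 ->
  exists g : K,
    (forall T : 'M[K]_(d, n), (forall i l, O (T i l)) ->
       exists2 s, O s & \det (colsub f N) * \det (T *m W) = s * g) /\
    (forall Q : set K^o, is_submodule O Q ->
       (forall h : 'I_d -> 'I_n, Q (\det (rowsub h W))) -> Q g).
Proof.
move=> mdn; subst n => ON NW.
pose E : 'M[K]_(m + d, m) := \matrix_(i, l) (i == f l)%:R.
(* Up to sign, [g] is the minor of [W] on the rows complementary to the image of [f], and 0 when [f]
   is not injective. The factor [s] will be the determinant of [N] stacked on [T]. *)
exists (\det (row_mx E W)); split=> [T OT|Q sQ QW].
  exists (\det (col_mx N T)).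
    apply: subring_det => // i l; rewrite mxE; case: (fintype.split i) => // ?.
  rewrite -det_mulmx mul_col_row NW det_lblock; congr (\det _ * _).
  apply/matrixP => i l; rewrite !mxE (bigD1 (f l)) //= mxE eqxx mulr1 big1 ?addr0 //.
  by move=> p pf; rewrite mxE (negPf pf) mulr0.
apply: (det_minors sO sQ) => [i l|h].
  rewrite row_mxEl mxE; case: eqP => _; [exact: (subring1 sO)|exact: (subring0 sO)].
have -> : \matrix_(i, l) row_mx E W (h i) (rshift m l) = rowsub h W; last exact: QW.
by apply/matrixP => i l; rewrite !mxE -/(unsplit (inr l)) unsplitK.
Qed.

(** * Derivations and differential forms *)

Section Derivations.
Context (k K : fieldType) (j : k -> K) (M : lmodType K) (D : K -> M).
Context (hD : is_derivation j D).

Lemma derD a b : D (a + b) = D a + D b. Proof. by case: hD. Qed.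
Lemma derM a b : D (a * b) = a *: D b + b *: D a. Proof. by case: hD. Qed.
Lemma der_base c : D (j c) = 0. Proof. by case: hD. Qed.

Lemma der0 : D 0 = 0.
Proof. by apply: (addrI (D 0)); rewrite -derD !addr0. Qed.

Lemma der1 : D 1 = 0.
Proof.
by apply: (addrI (D 1)); rewrite addr0 -{3}[1]mulr1 derM !scale1r.
Qed.

Lemma derN a : D (- a) = - D a.
Proof. by apply/eqP; rewrite -addr_eq0 -derD addNr der0. Qed.

Lemma derB a b : D (a - b) = D a - D b.
Proof. by rewrite derD derN. Qed.

Lemma derMn a n : D (a *+ n) = D a *+ n.
Proof. by elim: n => [|n IH]; rewrite ?mulr0n ?der0 // !mulrS derD IH. Qed.

Lemma derV a : D a^-1 = - a ^- 2 *: D a.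
Proof.
have [->|a0] := eqVneq a 0; first by rewrite invr0 der0 scaler0.
apply: (scalerI a0); rewrite scalerA.
have /eqP : D (a * a^-1) = 0 by rewrite mulfV // der1.
rewrite derM addr_eq0 => /eqP ->; rewrite -scaleNr; congr (_ *: _).
by field.
Qed.

Lemma der_div a b : b != 0 -> D (a / b) = b^-1 *: (D a - (a / b) *: D b).
Proof.
move=> b0; rewrite derM derV addrC scalerBr !scalerA; congr (_ + _).
by rewrite -scaleNr; congr (_ *: _); field.
Qed.

Context (W : set M) (sW : is_submodule setT W).

(** The chain rule modulo [W], for which the coefficients of [p] count as constants. *)
Lemma der_horner (p : {poly K}) z : (forall i, W (D p`_i)) ->
  W (D p.[z] - p^`().[z] *: D z).
Proof.
have [W0 WD WZ] := sW; elim/poly_ind: p => [|p c IH] Wp.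
  by rewrite deriv0 !horner0 der0 scale0r subr0.
have Wc : W (D c) by have := Wp 0; rewrite coefD coefMX coefC add0r.
have /IH {}IH i : W (D p`_i).
  by have := Wp i.+1; rewrite coefD coefMX coefC addr0.
rewrite derivD derivM derivX derivC !hornerE derD derM.
suff -> : p.[z] *: D z + z *: D p.[z] + D c - (p^`().[z] * z + p.[z]) *: D z =
    z *: (D p.[z] - p^`().[z] *: D z) + D c by apply: WD => //; exact: WZ.
rewrite scalerDl scalerBr scalerA [p^`().[z] * z]mulrC opprD.
by rewrite -!addrA [in LHS]addrC -!addrA addNr addr0 [_ + - _]addrC.
Qed.

Lemma der_subfield : is_subfield [set b | W (D b)].
Proof.
have [W0 WD WZ] := sW.
have WN x : W x -> W (- x) by move=> Wx; rewrite -scaleN1r; exact: WZ.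
split; [split=> /=|] => [|x y Wx Wy|x y Wx Wy|x Wx] /=.
- by rewrite der1.
- by rewrite derB; apply: WD => //; exact: WN.
- by rewrite derM; apply: WD; exact: WZ.
- by rewrite derV; exact: WZ.
Qed.

(** By the chain rule, [W] contains the product of the derivative of [q] at [z] with [D z]. If that
    derivative vanishes at [z], it replaces [q]: it is shorter, and in characteristic zero it is
    nonzero unless [q] is constant. *)
Lemma der_algebraic (S : set K) z : [pchar K] =i pred0 -> (forall x, S x -> W (D x)) ->
  algebraic_over_set (field_generated j S) z -> W (D z).
Proof.
move=> charK WS [q [q0 Fq qz]]; have [W0 WD WZ] := sW.
have Wq i : W (D q`_i).
  apply: (Fq i [set b | W (D b)]) => [|c|x]; [exact: der_subfield|by rewrite /= der_base|exact: WS].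
elim: {q}(size q) {-2}q (leqnn (size q)) q0 Wq qz {Fq} => [q|m IH q sq q0 Wq qz].
  by rewrite leqn0 size_poly_eq0 => ->.
have [dz|dz] := eqVneq (q^`().[z]) 0; last first.
  have := der_horner z Wq; rewrite (rootP qz) der0 sub0r => Wh.
  have := WZ (- (q^`().[z])^-1) _ I Wh.
  by rewrite scaleNr scalerN opprK scalerA mulVf // scale1r.
have [sq1|sq1] := leqP (size q) 1.
  move: qz q0; rewrite [q]size1_polyC // rootC => /eqP ->.
  by rewrite eqxx.
apply: (IH q^`()); last exact/rootP.
- by rewrite -ltnS (leq_trans (lt_size_deriv q0)).
- apply/eqP => dq0; move/polyP/(_ (size q).-2): dq0; rewrite coef_deriv coef0.
  have -> : (size q).-2.+1 = (size q).-1 by case: (size q) sq1 => [|[]].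
  rewrite -mulr_natr => /eqP; rewrite mulf_eq0 -/(lead_coef q) lead_coef_eq0 (negPf q0) /=.
  by rewrite (pcharf0P _).1 //; case: (size q) sq1 => [|[]].
- move=> i; rewrite coef_deriv derMn -scaler_nat; exact: WZ.
Qed.
End Derivations.

Lemma fraction_div (A : idomainType) (x : {fraction A}) :
  exists a b, b != 0 /\ x = to_ff a / to_ff b.
Proof.
elim/quotW: x => r; have d0 := denom_ratioP r.
exists (frac r).1, (frac r).2; split=> //.
have d0' : to_ff (frac r).2 != 0 by rewrite tofrac_eq0.
apply: (mulIf d0'); rewrite divfK // -[LHS]/(FracField.mul _ _).
rewrite /to_ff !piE /FracField.mulf; apply/eqmodP; rewrite /= FracField.equivfE /=.
by rewrite !numden_Ratio ?mulr1 ?oner_eq0 // mulrC.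
Qed.

Section ExtendDerivation.
Context (k A : comNzRingType) (K : fieldType) (iota : k -> A) (f : {rmorphism A -> K}).
Context (f_inj : injective f) (f_frac : forall x, exists a b, f b != 0 /\ x = f a / f b).
Context (D : A -> K).
Context (DD : forall a b, D (a + b) = D a + D b)
  (DM : forall a b, D (a * b) = f a * D b + f b * D a)
  (Dk : forall c, D (iota c) = 0).

(** [D'] is the quotient rule on a chosen fraction; [D'E] shows that every other fraction
    representing [x] gives the same value. *)
Lemma extend_derivation : exists D' : K -> K,
  @is_derivation k K (fun c => f (iota c)) K^o D' /\ forall a, D' (f a) = D a.
Proof.
have /choice[nd ndE] (x : K) : exists ab : A * A, f ab.2 != 0 /\ x = f ab.1 / f ab.2.
  by have [a [b [b0 xE]]] := f_frac x; exists (a, b).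
pose D' x := (f (nd x).2)^-1 * (D (nd x).1 - x * D (nd x).2).
have D'E x a b : f b != 0 -> x * f b = f a -> D' x = (f b)^-1 * (D a - x * D b).
  move=> b0 xb; have [e0 xE] := ndE x; set c := (nd x).1 in xE *; set e := (nd x).2 in e0 xE *.
  have xe : x * f e = f c by rewrite xE divfK.
  have : f a * f e = f b * f c by rewrite -xb -xe; ring.
  rewrite -!rmorphM => /f_inj /(congr1 D).
  rewrite !DM -xb -xe => H; rewrite /D' -/c -/e.
  have {}H : f e * (D a - x * D b) = f b * (D c - x * D e).
    apply/eqP; rewrite -subr_eq0; apply/eqP; move/eqP: H; rewrite -subr_eq0 => /eqP <-.
    ring.
  apply: (mulfI b0); apply: (mulfI e0).
  by rewrite (mulVKf b0) H; field.
have rep x : exists a b, [/\ x * f b = f a, f b != 0 &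
    D' x = (f b)^-1 * (D a - x * D b)].
  have [b0 xE] := ndE x; exists (nd x).1, (nd x).2.
  by split=> //; rewrite {1}xE divfK.
have D0 : D 1 = 0.
  have := DM 1 1; rewrite mulr1 rmorph1 !mul1r -{1}[D 1]addr0.
  by move/addrI.
have D'a a : D' (f a) = D a.
  by rewrite (D'E _ a 1) ?rmorph1 ?oner_eq0 ?D0 ?mulr1 // invr1 mulr0 subr0 mul1r.
have D'D x y : D' (x + y) = D' x + D' y.
  have [a [b [xb b0 ->]]] := rep x; have [c [e [ye e0 ->]]] := rep y.
  rewrite (D'E _ (a * e + c * b) (b * e)) ?rmorphD ?rmorphM ?mulf_neq0 //; last first.
    by rewrite -xb -ye; ring.
  by rewrite DD !DM -xb -ye; field; rewrite b0 e0.
have D'M x y : D' (x * y) = x * D' y + y * D' x.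
  have [a [b [xb b0 ->]]] := rep x; have [c [e [ye e0 ->]]] := rep y.
  rewrite (D'E _ (a * c) (b * e)) ?rmorphM ?mulf_neq0 //; last first.
    by rewrite -xb -ye; ring.
  by rewrite !DM -xb -ye; field; rewrite b0 e0.
by exists D'; split=> //; split=> // c; rewrite D'a Dk.
Qed.
End ExtendDerivation.

Lemma mspan_range (L : comNzRingType) (V : lmodType L) n (m : 'I_n -> V) v :
  mspan setT (range m) v -> exists c : 'rV[L]_n, v = \sum_l c 0 l *: m l.
Proof.
move=> [p [r [s [rs ->]]]].
have /choice[g gE] i : exists l, s i = m l by have [_ [l _ <-]] := rs i; exists l.
exists (\sum_i r i *: delta_mx 0 (g i)).
under [RHS]eq_bigr do rewrite summxE scaler_suml.
rewrite exchange_big; apply: eq_bigr => i _; rewrite (bigD1 (g i)) //= big1 => [|l li].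
  by rewrite !mxE !eqxx mulr1 addr0 gE.
by rewrite !mxE (negPf li) andbF mulr0 scale0r.
Qed.

(** An alias of [V] carrying the A-module structure along the morphism, so that a derivation of [A]
    with values in a K-module falls under the universal property of [Omega]. *)
Definition restrict_scalars (A K : comNzRingType) of {rmorphism A -> K} :=
  fun V : lmodType K => V : Type.

Section RestrictScalars.
Context (A K : comNzRingType) (f : {rmorphism A -> K}) (V : lmodType K).
HB.instance Definition _ := GRing.Zmodule.copy (restrict_scalars f V) V.

Definition restrict_scale (a : A) (v : restrict_scalars f V) : restrict_scalars f V :=
  f a *: (v : V).

Lemma restrict_scaleA a b v : restrict_scale a (restrict_scale b v) = restrict_scale (a * b) v.
Proof. by rewrite /restrict_scale scalerA rmorphM. Qed.
Lemma restrict_scale1 : left_id 1 restrict_scale.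
Proof. by move=> v; rewrite /restrict_scale rmorph1 scale1r. Qed.
Lemma restrict_scaleDr : right_distributive restrict_scale +%R.
Proof. by move=> a u v; rewrite /restrict_scale scalerDr. Qed.
Lemma restrict_scaleDl v : {morph restrict_scale^~ v : a b / a + b}.
Proof. by move=> a b; rewrite /restrict_scale rmorphD scalerDl. Qed.
HB.instance Definition _ := GRing.Zmodule_isLmodule.Build A (restrict_scalars f V)
  restrict_scaleA restrict_scale1 restrict_scaleDr restrict_scaleDl.
End RestrictScalars.

Lemma univ_gen_alternating (L : comNzRingType) (M : lmodType L) n :
  is_alternating (fun v : {ffun 'I_n -> M} => univ_gen _ v : Lambda n M).
Proof.
split=> [v i a x y|v i l il vil]; apply: univ_ext => N phi hphi; have [hm ha] := hphi.
  by rewrite [RHS]univ_evD // univ_evZ // !univ_ev_gen.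
by rewrite univ_ev_gen // [RHS]univ_ev0 // (ha _ i l).
Qed.

Lemma Omega_min (k L : comNzRingType) (j : k -> L) (Q : set (Omega j)) :
  is_submodule setT Q -> (forall a, Q (dOmega j a)) -> forall u, Q u.
Proof.
move=> sQ Qd u; rewrite [u]univ_fsum_gen; apply: (submodule_sum _ sQ) => p _.
by case: sQ => _ _; apply=> //; exact: Qd.
Qed.

Lemma Omega_semilinear (k A K : comNzRingType) (iota : k -> A) (tf : {rmorphism A -> K})
    (V : lmodType K) (c : A -> V) :
  @is_derivation k A iota (restrict_scalars tf V) c ->
  exists gam : Omega iota -> V, [/\ forall u v, gam (u + v) = gam u + gam v,
    forall a u, gam (a *: u) = tf a *: gam u
    & forall a, gam (dOmega iota a) = c a].
Proof.
move=> hc; exists (univ_ev (c : A -> restrict_scalars tf V)); split.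
- by move=> u v; exact: (univ_evD hc).
- by move=> a u; exact: (univ_evZ hc).
- by move=> a; exact: (univ_ev_gen _ hc).
Qed.

(** * Coordinates on rational differential forms *)

Section RationalForms.
Context (k : fieldType) (A : idomainType) (iota : {rmorphism k -> A}) (d : nat).
Local Notation K := {fraction A}.
Context (charK : [pchar K] =i pred0) (dimX : has_dim iota d).

(** [x] is a transcendence basis. The claim concerns all derivations [D], as it serves both for the
    universal one and for one with values in a cokernel of relations. *)
Lemma der_span : exists x : 'I_d -> K, forall (V : lmodType K) (D : K -> V),
  is_derivation (iotaK iota) D -> forall z, mspan setT (range (D \o x)) (D z).
Proof.
have [x [xalg _]] := dimX; exists x => W D hD z.
have sT : is_subring [set: K] by [].
apply: (der_algebraic hD (mspan_submodule sT _) charK _ (xalg z)) => _ [i _ <-].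
by apply: (mspan_incl sT); exists i.
Qed.

(** The differentials of a transcendence basis span the 1-forms, so their wedge spans the d-forms
    and is nonzero as soon as some d-form is. This forces them to be independent; [c] takes the
    coordinates of the differential. *)
Lemma ratform_coordinates : (exists w : ratform iota d, w != 0) ->
  exists (c : K -> 'rV[K]_d) (e : ratform iota d),
  [/\ is_derivation (iotaK iota) c, e != 0,
      forall b : 'I_d -> K, wedge (fun i => dOmega (iotaK iota) (b i)) =
        \det (\matrix_i c (b i)) *: e
    & forall w : ratform iota d, exists a, w = a *: e].
Proof.
move=> [w0 w0_neq0]; have [x xspan] := der_span.
pose e i := dOmega (iotaK iota) (x i).
have sT : is_subring [set: K] by [].
have espan u : mspan setT (range e) u.
  apply: Omega_min (mspan_submodule sT _) _ u => a.
  exact: (xspan _ _ (dOmega_derivation _)).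
have /choice[cf cfE] u : exists c : 'rV[K]_d, u = \sum_l c 0 l *: e l.
  exact: mspan_range.
pose wed (v : {ffun 'I_d -> Omega (iotaK iota)}) : ratform iota d := univ_gen _ v.
have wed_alt : is_alternating wed by exact: univ_gen_alternating.
have wedE v : wed v = \det (\matrix_i cf (v i)) *: wed (finfun e).
  rewrite -(alternating_det _ _ wed_alt); congr wed; apply/ffunP => i; rewrite ffunE.
  exact: cfE.
have wspan (w : ratform iota d) : exists a, w = a *: wed (finfun e).
  rewrite [w]univ_fsum_gen /fsum; elim: (generic_quotient.repr w) => [|p s [a IH]].
    by exists 0; rewrite big_nil scale0r.
  exists (p.1 * \det (\matrix_i cf (p.2 i)) + a).
  by rewrite big_cons IH -/(wed _) wedE scalerDl scalerA.
have e0 : wed (finfun e) != 0.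
  by have [a wE] := wspan w0; apply: contraNneq w0_neq0 => E; rewrite wE E scaler0.
(* Putting a linear relation into the i-th slot of the nonzero wedge leaves only its i-th
   coefficient. *)
have indep (c c' : 'rV[K]_d) : \sum_l c 0 l *: e l = \sum_l c' 0 l *: e l -> c = c'.
  move=> E; apply/rowP => i; apply/eqP; rewrite -subr_eq0.
  have {}E : \sum_l (c 0 l - c' 0 l) *: e l = 0.
    under eq_bigr do rewrite scalerBl.
    by rewrite sumrB E subrr.
  have [mwed awed] := wed_alt.
  have := multilinear_sum mwed (finfun e) i (fun l => c 0 l - c' 0 l) e.
  rewrite E (multilinear0 mwed) (bigD1 i) //= big1 ?addr0 => [|l li].
    have -> : ffun_upd (finfun e) i (e i) = finfun e.
      by rewrite -[in X in ffun_upd _ _ X](ffunE e) ffun_upd_id.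
    by move=> /esym/eqP; rewrite scaler_eq0 (negPf e0) orbF.
  by rewrite (awed _ i l) ?scaler0 // 1?eq_sym // !ffunE eqxx (negPf li).
have cf_lin a u v : cf (a *: u + v) = a *: cf u + cf v.
  apply: indep; rewrite -cfE {1}[u]cfE {1}[v]cfE scaler_sumr -big_split.
  by apply: eq_bigr => l _; rewrite !mxE scalerDl scalerA.
have cfD u v : cf (u + v) = cf u + cf v by have := cf_lin 1 u v; rewrite !scale1r.
have cf0 : cf 0 = 0 by apply: (addrI (cf 0)); rewrite -cfD !addr0.
have cfZ a u : cf (a *: u) = a *: cf u by have := cf_lin a u 0; rewrite !addr0 cf0 addr0.
have [hD hM hk] := dOmega_derivation (iotaK iota).
exists (fun z => cf (dOmega (iotaK iota) z)), (wed (finfun e)); split=> //.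
  by split=> [a b|a b|a]; rewrite ?hD ?hM ?hk ?cfD ?cfZ.
move=> b; rewrite -[LHS]/(wed _) wedE; congr (\det _ *: _).
by apply/matrixP => i l; rewrite !mxE ffunE.
Qed.
End RationalForms.

Lemma rowsub_free (F : fieldType) m n p (h : 'I_p -> 'I_m) (M : 'M[F]_(m, n)) :
  injective h -> row_free M -> row_free (rowsub h M).
Proof.
move=> inj_h fM; apply: inj_row_free => v; rewrite rowsubE mulmxA.
move=> /eqP; rewrite -[X in _ == X](mul0mx _ M) => /eqP/(row_free_inj fM) /rowP vh.
apply/rowP => i; have := vh (h i); rewrite !mxE (bigD1 i) //= !mxE eqxx mulr1.
by rewrite big1 ?addr0 // => l li; rewrite !mxE (inj_eq inj_h) (negPf li) mulr0.
Qed.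

Lemma free_minor (F : fieldType) m n (M : 'M[F]_(m, n)) : row_free M ->
  exists f : 'I_m -> 'I_n, \det (colsub f M) != 0.
Proof.
move=> fM; have full : row_full M^T by rewrite /row_full mxrank_tr.
exists (fullrankfun full).
have : rowsub (fullrankfun full) M^T \in unitmx by exact: fullrowsub_unit.
by rewrite unitmxE unitfE -trmx_mxsub det_tr.
Qed.

(** * Jacobian minors *)

Section JacobianMinors.
Context (k A : comNzRingType) (iota : k -> A) (K : fieldType) (tf : {rmorphism A -> K}).
Context (d : nat).

(* generators of jacobian_ideal, as in the definition of fitting_ideal *)
Definition jacobian_minors : set A :=
  [set x | exists n (m : 'I_n -> Omega iota) (N : 'M[A]_(n - d, n))
                  (f : 'I_(n - d) -> 'I_n),
     [/\ mspan setT (range m) = setT, forall a, \sum_l N a l *: m l = 0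
       & x = \det (colsub f N)]].

Lemma range_subring : is_subring (range tf).
Proof.
split=> [|_ _ [a _ <-] [b _ <-]|_ _ [a _ <-] [b _ <-]].
- by exists 1; rewrite ?rmorph1.
- by exists (a - b); rewrite ?rmorphB.
- by exists (a * b); rewrite ?rmorphM.
Qed.

(** The derivation [c] factors through the differentials of [A] by a semilinear [gam]. The matrix
    [W] of coordinates of the generators is therefore killed by the relations [N], and
    [relation_minor] applies. *)
Lemma jacobian_minor_bound (c : A -> 'rV[K]_d) x :
  @is_derivation k A iota (restrict_scalars tf 'rV[K]_d) c -> jacobian_minors x ->
  exists g : K,
    (forall b : 'I_d -> A, exists2 s, range tf s &
       tf x * \det (\matrix_i c (b i)) = s * g) /\
    (forall Q : set K^o, is_submodule (range tf) Q ->
       (forall b : 'I_d -> A, Q (\det (\matrix_i c (b i)))) -> Q g).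
Proof.
move=> hc [n [m [N [f [mgen mrel ->]]]]].
have [gam [gamD gamZ gamd]] := Omega_semilinear hc.
have gam0 : gam 0 = 0 by apply: (addrI (gam 0)); rewrite -gamD !addr0.
have gam_sum p (r : 'I_p -> A) (u : 'I_p -> Omega iota) :
    gam (\sum_l r l *: u l) = \sum_l tf (r l) *: gam (u l).
  apply: (big_rec2 (fun y z => gam y = z)) => // l y z _ <-.
  by rewrite gamD gamZ.
pose W : 'M[K]_(n, d) := \matrix_l gam (m l).
have TW (b : 'I_d -> A) : exists2 T : 'M[A]_(d, n), True &
    \matrix_i c (b i) = map_mx (tf) T *m W.
  have /choice[T TE] i : exists t : 'rV[A]_n, dOmega iota (b i) = \sum_l t 0 l *: m l.
    by apply: mspan_range; rewrite mgen.
  exists (\matrix_i T i) => //; apply/row_matrixP => i; rewrite rowK row_mul.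
  rewrite -gamd TE gam_sum mulmx_sum_row; apply: eq_bigr => l _.
  by rewrite !mxE rowK.
have detx : tf (\det (colsub f N)) = \det (colsub f (map_mx (tf) N)).
  by rewrite -map_mxsub -[LHS](det_map_mx tf).
(* With fewer than [d] generators, all the determinants vanish for reasons of rank, and [g] is 0. *)
have [le_dn|lt_nd] := leqP d n; last first.
  exists 0; split=> [b|Q [Q0 _ _] _ //].
  exists 0; first exact: (subring0 range_subring).
  have [T _ ->] := TW b; rewrite mul0r; apply/eqP; rewrite mulf_eq0; apply/orP; right.
  apply: contraTT lt_nd; rewrite -leqNgt -unitfE -unitmxE -row_free_unit => /eqP <-.
  by apply: leq_trans (mxrankM_maxl _ _) (rank_leq_col _).
have ON i l : range tf (map_mx (tf) N i l) by rewrite mxE; exists (N i l).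
have NW : map_mx (tf) N *m W = 0.
  apply/row_matrixP => i; rewrite row_mul mulmx_sum_row row0.
  transitivity (gam (\sum_l N i l *: m l)); last by rewrite mrel gam0.
  rewrite gam_sum; apply: eq_bigr => l _; by rewrite !mxE rowK.
have [g [gT gQ]] := relation_minor range_subring f (subnK le_dn) ON NW.
exists g; split=> [b|Q sQ Qdet].
  have [T _ ->] := TW b; rewrite detx; apply: gT => i l.
  by rewrite mxE; exists (T i l).
apply: gQ => // h.
have -> : rowsub h W = \matrix_i [ffun i => gam (m (h i))] i.
  by apply/row_matrixP => i; rewrite row_rowsub !rowK ffunE.
have spanQ := multilinear_span (@det_multilinear K d) (C := range c) sQ.
apply: (spanQ _ [ffun i => gam (m (h i))]) => [v vC|i].
  have /choice[b bE] i : exists a, v i = c a by have [a _ <-] := vC i; exists a.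
  have -> : \matrix_i v i = \matrix_i c (b i) by apply/row_matrixP => i; rewrite !rowK.
  exact: Qdet.
rewrite ffunE; move: (m (h i)); have [S0 SD SZ] := mspan_submodule range_subring (range c).
apply: Omega_min => [|a].
  split=> [|u v /= Su Sv|a u _ /= Su]; rewrite ?gam0 ?gamD ?gamZ //.
    exact: SD.
  by apply: SZ => //; exists a.
by rewrite /= gamd; apply: (mspan_incl range_subring); exists a.
Qed.

(** The elements whose differential lies in the span form a subalgebra containing [s]. *)
Lemma Omega_generators (s : seq A) : alg_generated iota s = setT ->
  mspan setT (range (fun l : 'I_(size s) => dOmega iota s`_l)) = setT.
Proof.
move=> sgen; apply/seteqP; split=> // u _.
have sT : is_subring [set: A] by [].
have sS := mspan_submodule sT (range (fun l : 'I_(size s) => dOmega iota s`_l)).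
have [S0 SD SZ] := sS; have [hD hM hk] := dOmega_derivation iota.
apply: Omega_min => // a; set S := mspan _ _ in sS S0 SD SZ *.
have : alg_generated iota s a by rewrite sgen.
move=> /(_ [set a | S (dOmega iota a)]); apply=> [|c|y].
- split=> [/=|x y /= Sx Sy|x y /= Sx Sy].
  + have -> : dOmega iota 1 = 0; last by [].
    by apply: (addrI (dOmega iota 1)); rewrite addr0 -{3}[1]mulr1 hM !scale1r.
  + have -> : dOmega iota (x - y) = dOmega iota x + (-1) *: dOmega iota y;
      last exact: SD (SZ _ _ _ _).
    apply: (addIr (dOmega iota y)).
    by rewrite -hD subrK scaleN1r addrNK.
  + by rewrite hM; apply: SD; exact: SZ.
- by rewrite /= hk.
- move=> ys; apply: (mspan_incl sT); have lty : (index y s < size s)%N by rewrite index_mem.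
  by exists (Ordinal lty) => //=; rewrite nth_index.
Qed.

(* Let N be a matrix of relations of maximal rank between the generators ds_l of
   Omega_A.  Then da = sum_l c_l ds_l |-> c mod N is a well-defined derivation to
   the cokernel of N over K; it extends to K, hence the cokernel has dimension at
   most d. *)
Lemma jacobian_minors_neq0 (s : seq A) : injective tf ->
  (forall x, exists a b, tf b != 0 /\ x = tf a / tf b) ->
  alg_generated iota s = setT ->
  (exists x : 'I_d -> K, forall (V : lmodType K) (D : K -> V),
     is_derivation (fun c => tf (iota c)) D -> forall z, mspan setT (range (D \o x)) (D z)) ->
  exists2 a, jacobian_minors a & a != 0.
Proof.
move=> tf_inj tf_frac sgen [x xspan]; set n := size s.
pose m (l : 'I_n) := dOmega iota s`_l.
have mgen : mspan setT (range m) = setT by exact: Omega_generators.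
pose rel (r : 'rV[A]_n) := \sum_l r 0 l *: m l = 0.
pose P r := `[< exists N : 'M[A]_(r, n), (forall i, rel (row i N)) /\
                  row_free (map_mx tf N) >].
have exP : exists r, P r.
  by exists 0%N; apply/asboolP; exists 0; split=> [[]//|]; rewrite /row_free flatmx0 mxrank0.
have Pn r : P r -> (r <= n)%N.
  by move=> /asboolP[N [_ /eqP <-]]; exact: rank_leq_col.
case: (ex_maxnP exP Pn) => r /asboolP[N [Nrel Nfree]] rmax.
(* A relation outside the row space of [N] over K could be appended to [N], against the maximality
   of [r]. *)
have relN r' : rel r' -> map_mx tf r' *m cokermx (map_mx tf N) = 0.
  move=> relr'; apply/eqP; rewrite -submxE; apply: contraT => nsub.
  have : (r.+1 <= r)%N; last by rewrite ltnn.
  rewrite -addn1; apply: rmax; apply/asboolP; exists (col_mx N r'); split=> [i|].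
    case: (fintype.split_ordP i) => l ->; first by rewrite rowKu.
    by rewrite rowKd [l]ord1 row_id.
  rewrite /row_free map_col_mx eqn_leq rank_leq_row /=.
  apply: leq_trans (_ : r.+1 <= _)%N; rewrite ?addn1 // -{1}(eqP Nfree).
  apply: rank_ltmx; rewrite ltmxE; apply/andP; split.
    by rewrite -addsmxE addsmxSl.
  by rewrite col_mx_sub negb_and nsub orbT.
have /choice[cf cfE] a : exists c : 'rV[A]_n, dOmega iota a = \sum_l c 0 l *: m l.
  by apply: mspan_range; rewrite mgen.
(* Multiplying by [cokermx] takes the class modulo the rows of [N]. *)
pose D a := map_mx tf (cf a) *m cokermx (map_mx tf N).
have relD (c c' : 'rV[A]_n) : \sum_l c 0 l *: m l = \sum_l c' 0 l *: m l ->
    map_mx tf c *m cokermx (map_mx tf N) = map_mx tf c' *m cokermx (map_mx tf N).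
  move=> E; apply/eqP; rewrite -subr_eq0 -mulmxBl -map_mxB; apply/eqP/relN.
  rewrite /rel; under eq_bigr do rewrite !mxE scalerBl.
  by rewrite sumrB E subrr.
have [hD hM hk] := dOmega_derivation iota.
have DD a b : D (a + b) = D a + D b.
  rewrite /D -mulmxDl -map_mxD; apply: relD; rewrite -cfE hD !cfE -big_split.
  by apply: eq_bigr => l _; rewrite !mxE scalerDl.
have DM a b : D (a * b) = tf a *: D b + tf b *: D a.
  rewrite /D !scalemxAl -mulmxDl -!map_mxZ -map_mxD; apply: relD.
  rewrite -cfE hM !cfE !scaler_sumr -big_split.
  by apply: eq_bigr => l _; rewrite !mxE scalerDl !scalerA.
have Dk c : D (iota c) = 0.
  rewrite /D -(mul0mx _ (cokermx (map_mx tf N))) -(map_mx0 tf); apply: relD.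
  rewrite -cfE hk big1 // => l _; by rewrite mxE scale0r.
have Ds (l : 'I_n) : D s`_l = row l (cokermx (map_mx tf N)).
  rewrite rowE -(map_delta_mx tf); apply: relD.
  rewrite -cfE -/(m l) (bigD1 l) //= big1 => [|i il]; first by rewrite mxE !eqxx scale1r addr0.
  by rewrite mxE (negPf il) andbF scale0r.
have /choice[D' D'E] (l : 'I_n) : exists D' : K -> K,
    @is_derivation k K (fun c => tf (iota c)) K^o D' /\ forall a, D' (tf a) = D a 0 l.
  by apply: (extend_derivation tf_inj tf_frac) => [a b|a b|c]; rewrite ?DD ?DM ?Dk !mxE.
pose DK z : 'rV[K]_n := \row_l D' l z.
have hDK : is_derivation (fun c => tf (iota c)) DK.
  split=> [a b|a b|c]; apply/rowP => l; have [[h1 h2 h3] _] := D'E l; rewrite !mxE.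
  - exact: h1.
  - exact: h2.
  - exact: h3.
(* The rows of the cokernel matrix are the images of the generators under the extended derivation,
   all in the span of its values at the [d] elements [x i]. *)
have rk : (\rank (cokermx (map_mx tf N)) <= d)%N.
  apply: leq_trans (mxrankS _) (rank_leq_row (\matrix_i DK (x i))).
  apply/row_subP => l; rewrite -Ds.
  have -> : D s`_l = DK (tf s`_l).
    by apply/rowP => i; have [_ D'i] := D'E i; rewrite [RHS]mxE D'i.
  have [p [c [v [cv ->]]]] := xspan _ _ hDK (tf s`_l).
  apply: summx_sub => i _; apply: scalemx_sub; have [_ [q _ <-]] := cv i.
  by rewrite /= -[DK (x q)](rowK (fun i => DK (x i)) q) row_sub.
(* The cokernel has rank [n - r]; hence [N] has enough independent rows for a minor of size
   [n - d]. *)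
have le_r : (n - d <= r)%N.
  by move: rk; rewrite mxrank_coker (eqP Nfree); lia.
pose N' := rowsub (widen_ord le_r) N.
have [|f fdet] := @free_minor _ _ _ (map_mx tf N').
  by rewrite map_mxsub; apply: rowsub_free Nfree => i l /(congr1 val)/= /val_inj.
exists (\det (colsub f N')).
  exists n, m, N', f; split=> // a; rewrite -[RHS](Nrel (widen_ord le_r a)).
  by apply: eq_bigr => l _; rewrite !mxE.
by move: fdet; rewrite -map_mxsub det_map_mx; apply: contraNneq => ->; rewrite rmorph0.
Qed.
End JacobianMinors.

(** * Comparison of the discrepancies *)

Section ValuationBounds.
Context (K : fieldType) (O : set K) (pi : K) (dvrO : is_dvr O pi).
Let sO : is_subring O. Proof. by case: dvrO. Qed.

Lemma vge_submodule n : is_submodule O (vge O pi n : set K^o).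
Proof.
split; [exact: (vge0x dvrO)|exact: (vgeD dvrO)|exact: (vgeZ dvrO)].
Qed.

Lemma lattice1 n : lattice O pi n (1 : K^o) = vge O pi n.
Proof.
apply/seteqP; split=> [_ [x hx <-]|x hx]; first by rewrite /GRing.scale /= mulr1.
by exists x => //; rewrite /GRing.scale /= mulr1.
Qed.

Lemma vge_seq_exists (s : seq K) : exists n, forall x, x \in s -> vge O pi n x.
Proof.
elim: s => [|x s [n sn]]; first by exists 0.
exists (Order.min n (dval O pi x)) => y; rewrite inE => /predU1P[->|/sn hy].
  have [->|x0] := eqVneq x 0; first exact: (vge0x dvrO).
  by apply/(vgeP dvrO) => //; rewrite ge_min lexx orbT.
by apply: (vge_le dvrO) hy; rewrite ge_min lexx.
Qed.

Lemma vge_det d m (M : 'M[K]_d) : (forall i l, vge O pi m (M i l)) ->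
  vge O pi (m *+ d) (\det M).
Proof.
move=> hM; apply: (submodule_sum _ (vge_submodule _)) => s _.
apply: (vgeZ dvrO).
  by apply: (subringX sO); apply: (subringN sO); exact: (subring1 sO).
suff prod_vge p (F : 'I_p -> K) : (forall i, vge O pi m (F i)) ->
    vge O pi (m *+ p) (\prod_i F i) by exact: prod_vge.
elim: p F => [|p IH] F hF.
  by rewrite big_ord0 mulr0n (vge_0E O pi); exact: (subring1 sO).
by rewrite big_ord_recr mulrSr /=; apply: (vgeM dvrO) => //; exact: IH.
Qed.

Lemma ord_ideal_val (S : set K) n : min_val O pi (S : set K^o) n 1 -> ord_ideal O S = n.
Proof.
move=> hS; rewrite /ord_ideal (mspan_lattice dvrO hS).
have OE : O = lattice O pi 0 (1 : K^o).
  by rewrite lattice1; apply/seteqP; split=> x; rewrite /= (vge_0E O pi x).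
by rewrite [in X in rel_ord _ _ X]OE (rel_ord_lattice dvrO) ?subr0 // oner_eq0.
Qed.

Lemma min_val1P (S : set K) n : min_val O pi (S : set K^o) n 1 <->
  S `<=` vge O pi n /\ exists c, [/\ c != 0, dval O pi c = n & S c].
Proof.
rewrite /min_val lattice1; split=> -[h [c [c0 vc Sc]]]; split=> //; exists c; split=> //.
  by move: Sc; rewrite /GRing.scale /= mulr1.
by rewrite /GRing.scale /= mulr1.
Qed.

Lemma ord_fun_val f : f != 0 -> ord_fun O f = dval O pi f.
Proof.
move=> f0; apply: ord_ideal_val; apply/min_val1P; split=> [_ ->|]; last by exists f.
by apply/(vgeP dvrO).
Qed.

Lemma min_val_scale (V : lmodType K) (S : set K) n (e : V) :
  min_val O pi (S : set K^o) n 1 -> min_val O pi [set x *: e | x in S] n e.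
Proof.
move=> /min_val1P[h [c [c0 vc Sc]]]; split=> [_ [x /h hx <-]|]; first by exists x.
by exists c; split=> //; exists c.
Qed.

Lemma min_val1_exists (S : set K) n : S `<=` vge O pi n ->
  (exists2 c, c != 0 & S c) -> exists m, min_val O pi (S : set K^o) m 1.
Proof.
move=> Sn [c c0 Sc]; apply: (min_val_exists dvrO) (_ : _ `<=` lattice O pi n 1) _ _.
- by rewrite lattice1.
- by exists c => //; rewrite /GRing.scale /= mulr1.
- exact: oner_neq0.
Qed.
End ValuationBounds.

(** * Orders of the determinants of a derivation *)

Section DerivationDeterminants.
Context (k K : fieldType) (j : k -> K) (d : nat) (c : K -> 'rV[K]_d).
Context (hc : is_derivation j c).

(** For the [c] of [ratform_coordinates], the coefficients with respect to [e] of the forms in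
    [dwedges B]. *)
Definition der_dets (B : set K) : set K :=
  [set x | exists2 b : 'I_d -> K, forall i, B (b i) & x = \det (\matrix_i c (b i))].

Lemma der_dets_incl B B' : B `<=` B' -> der_dets B `<=` der_dets B'.
Proof. by move=> BB' _ [b Bb ->]; exists b => // i; exact: BB'. Qed.

Lemma der_localization B P b : is_subring B -> is_prime B P -> localization B P b ->
  mspan (localization B P) (c @` B) (c b).
Proof.
move=> sB pP [x [s [Bx Bs nPs bE]]]; have sO := loc_subring sB pP.
have s0 : s != 0 by apply: contra_notN nPs => /eqP ->; case: pP => -[].
have Os' := loc_inv sB Bs nPs; have Bincl := loc_incl sB pP.
have [_ SD SZ] := mspan_submodule sO (c @` B).
rewrite bE (der_div hc) //; apply: (SZ) => //; rewrite -scaleNr; apply: SD.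
  by apply: (mspan_incl sO); exists x.
apply: SZ; last by apply: (mspan_incl sO); exists s.
by apply: (subringN sO); apply: (subringM sO) => //; exact: Bincl.
Qed.

(** By the quotient rule and multilinearity, the determinants over the localization lie in the span
    of those over [B], so the least order does not change. At a codimension one point of X this
    relates the order of [e] to that of the forms coming from [A]. *)
Lemma min_val_der_dets_loc B P pi n : is_subring B -> is_prime B P ->
  is_dvr (localization B P) pi ->
  min_val (localization B P) pi (der_dets B : set K^o) n 1 ->
  min_val (localization B P) pi (der_dets (localization B P) : set K^o) n 1.
Proof.
move=> sB pP dvrO /min_val1P[h [x [x0 vx Sx]]]; apply/min_val1P.
split; last first.
  by exists x; split=> //; apply: der_dets_incl Sx; exact: loc_incl.
move=> _ [b Ob ->].
have spanQ := multilinear_span (@det_multilinear K d) (C := c @` B) (vge_submodule dvrO n).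
have -> : \matrix_i c (b i) = \matrix_i [ffun i => c (b i)] i.
  by apply/row_matrixP => i; rewrite !rowK ffunE.
apply: (spanQ _ [ffun i => c (b i)]) => [v vC|i]; last first.
  by rewrite ffunE; exact: der_localization.
have /choice[a aE] i : exists a, B a /\ v i = c a by have [a Ba <-] := vC i; exists a.
apply: h; exists a => [i|]; first by case: (aE i).
by congr (\det _); apply/row_matrixP => i; rewrite !rowK; case: (aE i).
Qed.

(** The elements of [O] whose differential has coordinates of order at least [m] form a subalgebra.
    A bound [m] for the finitely many generators therefore holds on the whole algebra, and the
    determinants have order at least [m *+ d]. *)
Lemma der_dets_bounded s P pi : is_prime (alg_generated j s) P ->
  is_dvr (localization (alg_generated j s) P) pi ->
  exists n, der_dets (localization (alg_generated j s) P) `<=`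
            vge (localization (alg_generated j s) P) pi n.
Proof.
set B := alg_generated j s => pP dvrO; set O := localization B P in dvrO *.
have sB : is_subring B by exact: alg_generated_subring.
have sO : is_subring O by exact: loc_subring.
have BO : B `<=` O by exact: loc_incl.
have [m hm] := vge_seq_exists dvrO [seq c x 0 l | x <- s, l <- enum 'I_d].
pose S := [set x | O x /\ forall l, vge O pi m (c x 0 l)].
have vD x y : vge O pi m x -> vge O pi m y -> vge O pi m (x + y) by exact: (vgeD dvrO).
have vZ x y : O x -> vge O pi m y -> vge O pi m (x * y) by exact: (vgeZ dvrO).
have vN x : vge O pi m x -> vge O pi m (- x).
  by move=> hx; rewrite -mulN1r; apply: vZ => //; apply: (subringN sO); exact: (subring1 sO).
have BS : B `<=` S.
  move=> b; apply=> [|a|x xs].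
  - split=> [|x y [Ox hx] [Oy hy]|x y [Ox hx] [Oy hy]].
    + split=> [|l]; first exact: (subring1 sO).
      by rewrite (der1 hc) mxE; exact: (vge0x dvrO).
    + split=> [|l]; first exact: (subringB sO).
      by rewrite (derB hc) !mxE; apply: vD => //; exact: vN.
    + split=> [|l]; first exact: (subringM sO).
      by rewrite (derM hc) !mxE; apply: vD; exact: vZ.
  - split=> [|l]; first by apply: BO; exact: alg_generated_base.
    by rewrite (der_base hc) mxE; exact: (vge0x dvrO).
  - split=> [|l]; first by apply: BO; exact: alg_generated_gen.
    by apply: hm; apply/allpairsP; exists (x, l); rewrite mem_enum.
exists (m *+ d) => _ [b Ob ->]; apply: (vge_det dvrO) => i l; rewrite !mxE.
have hb := der_localization sB pP (Ob i).
suff : [set v : 'rV[K]_d | forall l, vge O pi m (v 0 l)] (c (b i)) by apply.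
apply: mspan_min hb.
  split=> [l'|u v hu hv l'|a u Oa hu l']; rewrite !mxE;
    [exact: (vge0x dvrO)|exact: vD|exact: vZ].
by move=> _ [x /BS[_ hx] <-].
Qed.
End DerivationDeterminants.

(** * The ring [A] inside its fraction field, and the orders of its forms *)

Section AffineVariety.
Context (k : fieldType) (A : idomainType) (iota : {rmorphism k -> A}) (d : nat).
Local Notation K := {fraction A}.
Local Notation tf := (@FracField.tofrac A).

Lemma tofrac_inj : injective tf.
Proof. by move=> a b /eqP; rewrite tofrac_eq => /eqP. Qed.

Lemma AK_subring : is_subring (@AK A).
Proof. exact: (range_subring tf). Qed.

Lemma fraction_field_AK (B : set K) : @AK A `<=` B -> fraction_field B.
Proof.
move=> AB z; have [a [b [b0 ->]]] := fraction_div z.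
exists (to_ff a), (to_ff b); split=> //; [by apply: AB; exists a|by apply: AB; exists b|].
by rewrite tofrac_eq0.
Qed.

Lemma alg_generated_iotaK_noetherian s : noetherian (alg_generated (iotaK iota) s).
Proof. exact: (@alg_generated_noetherian k K (tf \o iota) s). Qed.

Lemma AK_alg_generated : finite_type iota -> exists s, @AK A = alg_generated (iotaK iota) s.
Proof.
move=> [s sgen]; exists [seq to_ff x | x <- s]; set s' := map _ s.
have sS := alg_generated_subring (iotaK iota) s'.
apply/seteqP; split=> [_ [a _ <-]|z].
  have : alg_generated iota s a by rewrite sgen.
  move=> /(_ [set a | alg_generated (iotaK iota) s' (to_ff a)]); apply=> [|x|x xs].
  - split=> [|x y /= hx hy|x y /= hx hy] /=; rewrite /to_ff ?tofrac1 ?tofracB ?tofracM.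
    + exact: (subring1 sS).
    + exact: (subringB sS).
    + exact: (subringM sS).
  - exact: alg_generated_base.
  - by apply: alg_generated_gen; rewrite map_f.
apply=> [|x|y /mapP[x _ ->]]; [exact: AK_subring|by exists (iota x)|by exists x].
Qed.

Context (A_finite_type : finite_type iota).

Lemma AK_noetherian : noetherian (@AK A).
Proof. by have [s ->] := AK_alg_generated A_finite_type; exact: alg_generated_iotaK_noetherian. Qed.

Lemma center_prime E s P : E = localization (alg_generated (iotaK iota) s) P ->
  is_prime (alg_generated (iotaK iota) s) P -> @AK A `<=` E -> is_prime (@AK A) (center E).
Proof.
move=> EE pP AE; have sB := alg_generated_subring (iotaK iota) s.
have [[ME M0 MD MM] nM1 Mp] : is_prime E (max_ideal E).
  by rewrite EE; exact: loc_max_ideal_prime.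
have sA := AK_subring; split.
- split=> [x []//|//|x y [Ax Mx] [Ay My]|b x Ab [Ax Mx]].
  + by split; [exact: (subring0 sA)|].
  + by split; [exact: (subringD sA)|exact: MD].
  + by split; [exact: (subringM sA)|apply: MM => //; exact: AE].
- by case.
- move=> x y Ax Ay [_ Mxy].
  by have [||Mx|My] := Mp x y _ _ Mxy; [exact: AE..|left|right].
Qed.

Context (c : K -> 'rV[K]_d) (e : ratform iota d).
Context (hc : is_derivation (iotaK iota) c) (e0 : e != 0).
Context (wedgeE : forall b : 'I_d -> K, wedge (fun i => dOmega (iotaK iota) (b i)) =
        \det (\matrix_i c (b i)) *: e).

Lemma dwedgesE B : dwedges B = [set x *: e | x in der_dets c B].
Proof.
apply/seteqP; split=> [_ [b [Bb ->]]|_ [_ [b Bb ->] <-]].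
  by exists (\det (\matrix_i c (b i))); rewrite -?wedgeE //; exists b.
by exists b; split=> //; rewrite wedgeE.
Qed.

(** Differentials of fractions are K-combinations of differentials of elements of [A]. If all
    determinants over [A] vanished, so would every rational d-form, including [e]. *)
Lemma der_dets_AK_neq0 : exists2 x, x != 0 & der_dets c (@AK A) x.
Proof.
apply: contrapT => det0.
have {}det0 x : der_dets c (@AK A) x -> x = 0.
  by move=> hx; apply/eqP/negP => /negP x0; apply: det0; exists x.
have sT : is_subring [set: K] by [].
pose wed (v : {ffun 'I_d -> Omega (iotaK iota)}) : ratform iota d := univ_gen _ v.
have mwed : is_multilinear wed by have [] := univ_gen_alternating (Omega (iotaK iota)) d.
have wed0 v : wed v = 0.
  have zeroS : is_submodule setT [set (0 : ratform iota d)].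
    by split=> [|x y -> ->|a x _ ->] //=; rewrite ?addr0 ?scaler0.
  apply: (multilinear_span mwed zeroS (C := dOmega (iotaK iota) @` @AK A)) => [u uA|i].
    have /choice[b bE] i : exists b, @AK A b /\ u i = dOmega (iotaK iota) b.
      by have [b Ab ub] := uA i; exists b.
    have -> : u = [ffun i => dOmega (iotaK iota) (b i)].
      by apply/ffunP => i; rewrite ffunE (proj2 (bE i)).
    rewrite -[wed _]/(wedge (fun i => dOmega (iotaK iota) (b i))).
    rewrite wedgeE (det0 (\det (\matrix_i c (b i)))) ?scale0r //.
    by exists b => // i; exact: (proj1 (bE i)).
  have sM := mspan_submodule sT (dOmega (iotaK iota) @` @AK A); have [_ SD SZ] := sM.
  apply: Omega_min sM _ _ => z; have [a [b [b0 ->]]] := fraction_div z.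
  have hD := dOmega_derivation (iotaK iota).
  rewrite (der_div hD) ?tofrac_eq0 //; apply: (SZ) => //; rewrite -scaleNr.
  apply: SD; first by apply: (mspan_incl sT); exists (to_ff a) => //; exists a.
  by apply: SZ => //; apply: (mspan_incl sT); exists (to_ff b) => //; exists b.
move: e0; rewrite [e]univ_fsum_gen /fsum big1 ?eqxx // => p _.
by rewrite -/(wed p.2) wed0 scaler0.
Qed.

Lemma ord_form_val O pi n a : is_dvr O pi -> a != 0 ->
  min_val O pi (der_dets c O : set K^o) n 1 ->
  ord_form O (a *: e) = dval O pi a - n.
Proof.
move=> dvrO a0 hn; rewrite /ord_form /Omega_top dwedgesE.
rewrite (mspan_lattice dvrO (min_val_scale e hn)).
have hw : min_val O pi [set a *: e] (dval O pi a) e.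
  split=> [_ ->|]; last by exists a.
  by exists a => //; apply/(vgeP dvrO).
by rewrite (mspan_lattice dvrO hw) (rel_ord_lattice dvrO).
Qed.

Lemma ord_mather_val O pi n m : is_dvr O pi ->
  min_val O pi (der_dets c (@AK A) : set K^o) n 1 ->
  min_val O pi (der_dets c O : set K^o) m 1 ->
  ord_mather iota d O = n - m.
Proof.
move=> dvrO hn hm; rewrite /ord_mather /pullback_Omega_top /Omega_top !dwedgesE.
rewrite (mspan_lattice dvrO (min_val_scale e hn)) (mspan_lattice dvrO (min_val_scale e hm)).
exact: (rel_ord_lattice dvrO).
Qed.
End AffineVariety.

Section Comparison.
Context (k : fieldType) (k_char0 : [pchar k] =i pred0).
Context (A : idomainType) (iota : {rmorphism k -> A}) (d : nat).
Context (A_finite_type : finite_type iota) (dimX : has_dim iota d) (X_normal : is_normal A).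
Local Notation K := {fraction A}.

Lemma pchar_fraction : [pchar K] =i pred0.
Proof.
apply/pcharf0P => n; have <- := (pcharf0P k).1 k_char0 n.
rewrite -[n%:R in LHS](rmorph_nat (@FracField.tofrac A)) tofrac_eq0.
by rewrite -(rmorph_nat iota) fmorph_eq0.
Qed.

Lemma prime_divisor_dvr E : prime_divisor_over iota E ->
  exists s P pi, [/\ E = localization (alg_generated (iotaK iota) s) P,
    is_prime (alg_generated (iotaK iota) s) P, @AK A `<=` alg_generated (iotaK iota) s
    & is_dvr E pi].
Proof.
move=> [n [U [[Ufg AU _] Unormal [i [P [hP ->]]]]]].
have [s Us] := Ufg i; have {}AU := AU i; have {}Unormal := Unormal i; rewrite Us in hP AU Unormal *.
have [pi dvrE] := localization_dvr (alg_generated_subring _ _)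
  (@alg_generated_iotaK_noetherian _ _ iota s) Unormal (fraction_field_AK AU) hP.
by exists s, P, pi; split=> //; case: hP.
Qed.

(** The comparison of discrepancies multiplied by [r], in order to stay within the integers. *)
Lemma mather_minus_jacobian_le E r (w : ratform iota d) f : prime_divisor_over iota E ->
  w != 0 -> local_equation r w (center E) f ->
  (ord_mather iota d E - ord_jac iota d E - ord_form E w) *+ r + ord_fun E f <= 0.
Proof.
move=> /prime_divisor_dvr[sE [PE [pi [EE pPE AUE dvrE]]]] w0 [f0 [s0 [As0 ns0 eqf]]].
have sA : is_subring (@AK A) := @AK_subring A.
have AE : @AK A `<=` E.
  by rewrite EE => x /AUE; apply: loc_incl => //; exact: alg_generated_subring.
have charK := pchar_fraction.
have [c [e [hc e0 wedgeE wspan]]] := ratform_coordinates charK dimX (ex_intro _ w w0).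
have [a wE] := wspan w.
have a0 : a != 0 by apply: contraNneq w0 => a0; rewrite wE a0 scale0r.
have det_neq0 := der_dets_AK_neq0 e0 wedgeE.
(* [m] and, below, [n] are the least orders along E of the determinants over [E] and over [A]. The
   Mather discrepancy is [n - m] and [w] has order [dval E pi a - m], so [m] will cancel. *)
have [m Em] : exists m, min_val E pi (der_dets c E : set K^o) m 1.
  have [n hn] : exists n, der_dets c E `<=` vge E pi n.
    by rewrite EE in dvrE *; exact: (der_dets_bounded hc pPE dvrE).
  apply: (min_val1_exists dvrE hn); have [x x0 hx] := det_neq0.
  by exists x => //; exact: der_dets_incl hx.
have [n En] : exists n, min_val E pi (der_dets c (@AK A) : set K^o) n 1.
  have /min_val1P[hm _] := Em; apply: (min_val1_exists dvrE) det_neq0 => x /(der_dets_incl AE).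
  exact: hm.
rewrite (ord_mather_val e0 wedgeE dvrE En Em) wE (ord_form_val e0 wedgeE dvrE a0 Em).
rewrite (ord_fun_val dvrE f0).
pose tf := @FracField.tofrac A.
have tf_inj : injective tf by exact: tofrac_inj.
have minors_neq0 : exists2 x, x != 0 & (tf @` jacobian_minors iota d) x.
  have [s sgen] := A_finite_type.
  have tf_frac x : exists a b, tf b != 0 /\ x = tf a / tf b.
    by have [y [z [z0 ->]]] := fraction_div x; exists y, z; rewrite tofrac_eq0.
  have [x hx x0] := @jacobian_minors_neq0 k A iota K tf d s tf_inj tf_frac sgen
    (der_span charK dimX).
  by exists (tf x); [rewrite tofrac_eq0|exists x].
have tfE x : E (tf x) by apply: AE; exists x.
(* The minors lie in [A], so their orders are bounded below by 0; [x] will be a minor attaining the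
   least order [p]. *)
have [p Ep] : exists p, min_val E pi (tf @` jacobian_minors iota d : set K^o) p 1.
  by apply: (min_val1_exists dvrE (n := 0)) minors_neq0 => _ [x _ <-]; rewrite (vge_0E E pi).
have /min_val1P[hp [y [tx0 vx [x hx xE]]]] := Ep; rewrite -{y}xE in tx0 vx.
have -> : ord_jac iota d E = p.
  apply: (ord_ideal_val dvrE); apply/min_val1P; split=> [_ [u Ju <-]|]; last first.
    by exists (tf x); split=> //; exists x => //; apply: (@mspan_incl A setT _ A^o).
  apply: (mspan_min (Q := [set y : A^o | vge E pi p (tf y)])) Ju => [|z hz]; last first.
    by apply: hp; exists z.
  split=> [|y z /= hy hz|y z _ /= hz].
  - by rewrite /= [tf _]tofrac0; exact: (vge0x dvrE).
  - have -> : tf (y + z) = tf y + tf z by exact: tofracD.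
    exact: (vgeD dvrE).
  - have -> : tf (y *: z) = tf y * tf z by exact: tofracM.
    exact: (vgeZ dvrE).
have hcA : @is_derivation k A iota (restrict_scalars tf 'rV[K]_d) (fun y => c (tf y)).
  have [cD cM ck] := hc.
  by split=> [y z|y z|y]; rewrite ?[tf (_ + _)]tofracD ?[tf (_ * _)]tofracM ?cD ?cM //; exact: ck.
have [g [gdet gspan]] := jacobian_minor_bound hcA hx.
have AK_dets (b : 'I_d -> A) : der_dets c (@AK A) (\det (\matrix_i c (tf (b i)))).
  by exists (tf \o b) => // i; exists (b i).
have dets_AK y : der_dets c (@AK A) y -> exists b : 'I_d -> A, y = \det (\matrix_i c (tf (b i))).
  move=> [b Ab ->]; have /choice[b' b'E] i : exists z, b i = tf z.
    by have [z _ <-] := Ab i; exists z.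
  exists b'; congr (\det _); apply/row_matrixP => i; by rewrite !rowK b'E.
have g0 : g != 0.
  have [y y0 /dets_AK[b yE]] := det_neq0; have [s _] := gdet b; rewrite -yE => sg.
  by apply: contraNneq (mulf_neq0 tx0 y0) => g0; rewrite sg g0 mulr0.
(* [g] lies in the [A]-span of the determinants over [A], all of order at least [n]. *)
have ng : n <= dval E pi g.
  apply/(vgeP dvrE) => //; apply: (gspan (vge E pi n : set K^o)).
    have [V0 VD VZ] := vge_submodule dvrE n; split=> // y z Ay; apply: VZ; exact: AE.
  by move=> b; have /min_val1P[h _] := En; exact: h.
have pC : is_prime (@AK A) (center E) := center_prime EE pPE AE.
have cM : is_subring E by case: dvrE.
have tag0 : tf x * a / g != 0 by rewrite !mulf_neq0 ?invr_eq0.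
have zreg : localization (@AK A) (center E) ((tf x * a / g) ^+ r / f).
  have nA := AK_noetherian A_finite_type.
  have fA : fraction_field (@AK A) by exact: fraction_field_AK.
  apply: (codim1_regular sA nA X_normal fA pC As0 ns0) => P hP nPs0.
  have pP : is_prime (@AK A) P by case: hP.
  have [rho dvrO] := localization_dvr sA nA X_normal fA hP; set O := localization _ P in dvrO *.
  have [sg sgE] := AK_alg_generated A_finite_type.
  have [q hq] : exists q, min_val O rho (der_dets c (@AK A) : set K^o) q 1.
    have [q hq] : exists q, der_dets c O `<=` vge O rho q.
      move: (dvrO); rewrite /O sgE => dvrO'; apply: (der_dets_bounded hc _ dvrO').
      by rewrite -sgE.
    apply: (min_val1_exists dvrO) det_neq0 => y hy; apply: hq; apply: der_dets_incl hy.
    exact: loc_incl.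
  have hq' := min_val_der_dets_loc hc sA pP dvrO hq.
  have := eqf P hP nPs0; rewrite (ord_fun_val dvrO f0) wE (ord_form_val e0 wedgeE dvrO a0 hq').
  (* [y] attains the least order [q] at [P], and [tf x * y = s * g] with [s] in [A]. So the order of
     [g] is at most that of [tf x] plus [q], while [f] has [r] times the order of [a] minus [q]. *)
  move=> vf; have /min_val1P[_ [y [y0 vy /dets_AK[b yE]]]] := hq.
  have [s As] := gdet b; rewrite -yE => sgy.
  have s_neq0 : s != 0.
    by apply: contraNneq (mulf_neq0 tx0 y0) => s_0; rewrite sgy s_0 mul0r.
  have vs : 0 <= dval O rho s by apply/(dvr_val dvrO) => //; exact: loc_incl.
  have : dval O rho (tf x * y) = dval O rho s + dval O rho g by rewrite sgy (dvalM dvrO).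
  rewrite (dvalM dvrO) // vy => vxq.
  apply/(dvr_val dvrO); first by rewrite mulf_neq0 ?expf_neq0 ?invr_eq0.
  rewrite (dvalM dvrO) ?expf_neq0 ?invr_eq0 // (dvalX dvrO) // (dvalV dvrO) // vf.
  rewrite !(dvalM dvrO) ?mulf_neq0 ?invr_eq0 // (dvalV dvrO) // -mulrnBl.
  by apply: mulrn_wge0; lia.
have Ez : E ((tf x * a / g) ^+ r / f).
  have [b [s [Ab As ns ->]]] := zreg; apply: (subringM cM); first exact: AE.
  (* An element of [A] outside the center is a unit of [E]. *)
  apply: contrapT => nEs; apply: ns; split=> //; split; first exact: AE.
  by right.
have : 0 <= dval E pi ((tf x * a / g) ^+ r / f).
  by apply/(dvr_val dvrE) => //; rewrite mulf_neq0 ?expf_neq0 ?invr_eq0.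
rewrite (dvalM dvrE) ?expf_neq0 ?invr_eq0 // (dvalX dvrE) // (dvalV dvrE) //.
rewrite !(dvalM dvrE) ?mulf_neq0 ?invr_eq0 // (dvalV dvrE) // vx.
have : (n - m - p - (dval E pi a - m)) *+ r <= (- (p + dval E pi a - dval E pi g)) *+ r.
  by apply: ler_wMn2r; lia.
rewrite mulNrn; move: (_ *+ r) (_ *+ r) => u v; lia.
Qed.

Lemma a_MJ_le_a_usual (R : realType) (I : set A) (t : R) E :
  Q_Gorenstein iota d -> prime_divisor_over iota E ->
  a_MJ iota d I t E <= a_usual iota d I t E.
Proof.
move=> [r r0 rKC] pE; rewrite /a_MJ /a_usual lerD2r lerD2r.
have [w w0 /(_ (center E)) hw] := rKC.
have [s [P [pi [EE pP AU dvrE]]]] := prime_divisor_dvr pE.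
have AE : @AK A `<=` E.
  by rewrite EE => x /AU; apply: loc_incl => //; exact: alg_generated_subring.
have [f hf] := hw (center_prime EE pP AE).
rewrite /ord_KYX; case: xgetP => [y -> [r' [w' [f' [r'0 _ w'0 hf' ->]]]]|]; last first.
  by move=> /(_ ((ord_form E w)%:~R - (ord_fun E f)%:~R / r%:R)) []; exists r, w, f.
have := mather_minus_jacobian_le pE w'0 hf'.
rewrite -(ler_int R) rmorphD rmorphMn !rmorphB /= -mulr_natr.
set M := (ord_mather _ _ _)%:~R; set J := (ord_jac _ _ _)%:~R; set F := (ord_form _ _)%:~R.
set f0 := (ord_fun _ _)%:~R => h.
have r'R : 0 < r'%:R :> R by rewrite ltr0n.
suff : f0 / r'%:R <= F - (M - J) by lra.
rewrite ler_pdivrMr //; have -> : (F - (M - J)) * r'%:R = - ((M - J - F) * r'%:R) by ring.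
lra.
Qed.
End Comparison.

Theorem proposition1p2
  (k : closedFieldType) (k_uncountable : ~ countable [set: k])
  (k_char0 : [pchar k] =i pred0)
  (A : idomainType) (iota : {rmorphism k -> A}) (d : nat)
  (A_finite_type : finite_type iota) (dimX : has_dim iota d)
  (X_normal : is_normal A) (X_QGor : Q_Gorenstein iota d)
  (a : set A) (a_ideal : is_ideal [set: A] a) (a_neq0 : exists2 f, a f & f != 0)
  (R : realType) (t : R) (t_ge0 : 0 <= t) :
  [/\ is_MJ_canonical iota d a t -> is_canonical iota d a t,
      is_MJ_log_canonical iota d a t -> is_log_canonical iota d a t,
      is_MJ_terminal iota d a t -> is_terminal iota d a t,
      is_MJ_log_terminal iota d a t -> is_log_terminal iota d a t
    & is_MJ_klt iota d a t -> is_klt iota d a t].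
Proof.
have le_a E : prime_divisor_over iota E -> a_MJ iota d a t E <= a_usual iota d a t E.
  exact: a_MJ_le_a_usual.
split=> [h E pE xE|h E pE xE|h E pE xE|h E pE xE|h E pE].
- exact: le_trans (h E pE xE) (le_a E pE).
- exact: le_trans (h E pE xE) (le_a E pE).
- exact: lt_le_trans (h E pE xE) (le_a E pE).
- exact: lt_le_trans (h E pE xE) (le_a E pE).
- exact: lt_le_trans (h E pE) (le_a E pE).
Qed.
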